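(* Let $m \geq 7$ and $n \geq (m-3)(m-1)$ be integers. Then the star-critical Ramsey number satisfies $r_*(C_n, K_m) = (m-2)(n-1)+2$.
   Context: All graphs are finite and simple. $C_n$ is the cycle on $n$ vertices and $K_m$ the complete graph on $m$ vertices. For graphs $F, G, H$, write $F \rightarrow (G,H)$ if every coloring of the edges of $F$ with two colors, red and blue, contains a red subgraph isomorphic to $G$ or a blue subgraph isomorphic to $H$. The Ramsey number $r(G,H)$ is the smallest positive integer $N$ with $K_N \rightarrow (G,H)$. For integers $N \geq 1$ and $0 \le k \le N$, $K_N \sqcup K_{1,k}$ denotes the graph obtained from $K_N$ by adding one new vertex joined to exactly $k$ vertices of $K_N$. The star-critical Ramsey number $r_*(G,H)$ is the smallest integer $k$ such that $K_{r(G,H)-1} \sqcup K_{1,k} \rightarrow (G,H)$. *)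

(* Defs.v *)
From mathcomp Require Import all_boot.

Set Implicit Arguments.
Unset Strict Implicit.
Unset Printing Implicit Defensive.

Record sgraph := SGraph {
  vertex :> finType;
  adj : rel vertex;
  adj_sym : symmetric adj;
  adj_irr : irreflexive adj
}.

Section Complete.
Variable n : nat.
Definition complete_rel : rel 'I_n := fun i j => i != j.
Lemma complete_sym : symmetric complete_rel.
Proof. by move=> i j; rewrite /complete_rel eq_sym. Qed.
Lemma complete_irr : irreflexive complete_rel.
Proof. by move=> i; rewrite /complete_rel eqxx. Qed.
Definition complete : sgraph := SGraph complete_sym complete_irr.
End Complete.

(* [ordS] is the cyclic successor on 'I_n.  This is the cycle on n vertices
   for n >= 3; the disequality only matters for n = 1, where it removes the
   loop. *)
Section Cycle.
Variable n : nat.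
Definition cycle_rel : rel 'I_n :=
  fun i j => (i != j) && ((j == ordS i) || (i == ordS j)).
Lemma cycle_sym : symmetric cycle_rel.
Proof. by move=> i j; rewrite /cycle_rel eq_sym orbC. Qed.
Lemma cycle_irr : irreflexive cycle_rel.
Proof. by move=> i; rewrite /cycle_rel eqxx. Qed.
Definition cycle_graph : sgraph := SGraph cycle_sym cycle_irr.
End Cycle.

(* K_N \sqcup K_{1,k}: the new vertex is [None], joined to the k vertices
   0, ..., k-1 of K_N.  Only meaningful for k <= N. *)
Section CompleteStar.
Variables N k : nat.
Definition complete_star_rel : rel (option 'I_N) := fun x y =>
  match x, y with
  | Some i, Some j => i != j
  | None, Some i | Some i, None => i < k
  | None, None => false
  end.
Lemma complete_star_sym : symmetric complete_star_rel.
Proof. by case=> [i|] [j|] //=; rewrite eq_sym. Qed.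
Lemma complete_star_irr : irreflexive complete_star_rel.
Proof. by case=> [i|] //=; rewrite eqxx. Qed.
Definition complete_star : sgraph :=
  SGraph complete_star_sym complete_star_irr.
End CompleteStar.

(* An edge xy is the unordered pair [set x; y]; [c] is a colouring of
   unordered pairs, and only its values on the edges of F are ever used. *)
Section ColorClass.
Variables (F : sgraph) (c : {set F} -> bool) (b : bool).
Definition color_rel : rel F := fun x y => adj x y && (c [set x; y] == b).
Lemma color_sym : symmetric color_rel.
Proof. by move=> x y; rewrite /color_rel adj_sym setUC. Qed.
Lemma color_irr : irreflexive color_rel.
Proof. by move=> x; rewrite /color_rel adj_irr. Qed.
Definition color_class : sgraph := SGraph color_sym color_irr.
End ColorClass.

(* F has a (not necessarily induced) subgraph isomorphic to G. *)
Definition has_subgraph (F G : sgraph) : Prop :=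
  exists2 f : G -> F, injective f & forall x y, adj x y -> adj (f x) (f y).

(* F -> (G, H), with red = true and blue = false. *)
Definition arrows (F G H : sgraph) : Prop :=
  forall c : {set F} -> bool,
    has_subgraph (color_class c true) G \/ has_subgraph (color_class c false) H.

Definition is_least (P : nat -> Prop) (k : nat) : Prop :=
  P k /\ forall j, P j -> k <= j.

(* r(G, H) = r *)
Definition is_ramsey_number (G H : sgraph) (r : nat) : Prop :=
  is_least (fun N => 0 < N /\ arrows (complete N) G H) r.

(* r_*(G, H) = k *)
Definition is_star_critical_number (G H : sgraph) (k : nat) : Prop :=
  exists2 r, is_ramsey_number G H r &
    is_least (fun j => j <= r.-1 /\ arrows (complete_star r.-1 j) G H) k.

(* Main.v *)
Require Import Defs.
From mathcomp Require Import all_boot zify.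

(** Write [k = m - 1] and work in the red graph.  The core statement, proved by
    induction on [k], is that a graph on [k(n-1)] vertices with no [C_n] and
    independence number at most [k] contains [k] disjoint cliques [K_(n-1)].
    Any vertex outside such a clique has at most one neighbour in it, so a
    greedy choice of one vertex per clique then produces the blue [K_m].

    If deleting some [n-1] vertices lowers the independence number, induction
    applies.  Otherwise every complement of at most [n-1] vertices contains an
    independent [k]-set, which dominates the graph, and the minimum degree is at
    least [n-1].  If no cycle on [V(C)] and one more vertex [x] exists, then [x]
    together with the successors on [C] of its neighbours is independent.  This
    gives two tools: a cycle through a large set of small independence number
    can be extended one vertex at a time up to length [n]; consequently every
    [n-k] neighbours of a vertex contain an independent triple.  A longest cycle
    of length [l < n] has [l > n - 2k], since chords shorten long cycles by less
    than [2k].  If [l < n-1], independent triples among the outside neighbours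
    bound the number of neighbours on [C] of each outside vertex by [k-3], and
    the dominating set cannot cover [C].  If [l = n-1], the vertices of [C] seen
    by exactly one dominating vertex form cliques, and rerouting [C] through
    these cliques shows that they are too small to cover [C]. *)

Set Implicit Arguments.
Unset Strict Implicit.
Unset Printing Implicit Defensive.

(** * Walks, cutting cycles open, and absorbing outside paths into cycles *)

Section Walks.
Variables (T : finType) (e : rel T).
Hypotheses (e_sym : symmetric e) (e_irr : irreflexive e).

(** The list holds every vertex, both ends included, so that joining two walks by an edge is
    concatenation and lengths simply add. *)
Definition walk (a b : T) (s : seq T) : bool :=
  if s is c :: s' then [&& c == a, path e c s' & last c s' == b] else false.
Arguments walk : simpl never.

Lemma walk1 a : walk a a [:: a].
Proof. by rewrite /walk /= !eqxx. Qed.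

Lemma walk_path a p : path e a p -> walk a (last a p) (a :: p).
Proof. by rewrite /walk /= !eqxx andbT. Qed.

Lemma walk_cat a b c d s t :
  walk a b s -> e b c -> walk c d t -> walk a d (s ++ t).
Proof.
case: s => // x s; case: t => // y t /and3P[/eqP-> ps /eqP lb] ebc.
case/and3P=> /eqP-> pt /eqP ld; rewrite /walk /= eqxx cat_path ps /=.
by rewrite last_cat /= lb ebc pt ld eqxx.
Qed.

Lemma walk_cons a b c s : e a b -> walk b c s -> walk a c (a :: s).
Proof. exact: walk_cat (walk1 a). Qed.

Lemma walk_rev a b s : walk a b s -> walk b a (rev s).
Proof.
case: s => // x s /and3P[/eqP-> ps /eqP<-].
rewrite lastI rev_rcons /walk eqxx /=.
rewrite rev_path (eq_path (e' := e)) ?ps /=; last by move=> u v; exact: e_sym.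
by rewrite -(last_rcons a (rev (belast a s)) a) -rev_cons; case: (s) => //= *;
   rewrite ?rev_cons ?last_rcons ?eqxx // -rev_cons rev_cons last_rcons.
Qed.

Lemma walk_cycle a b s : walk a b s -> e b a -> cycle e s.
Proof.
by case: s => // x s /and3P[/eqP-> ps /eqP lb] eba; rewrite /= rcons_path ps lb.
Qed.

Lemma next_mid (p q : seq T) b c :
  uniq (p ++ b :: c :: q) -> next (p ++ b :: c :: q) b = c.
Proof.
by move=> us; rewrite -(next_rot (size p) us) rot_size_cat /= eqxx.
Qed.

Lemma cut1 s a : cycle e s -> uniq s -> a \in s ->
  exists2 p, perm_eq p s & walk (next s a) a p.
Proof.
move=> cs us /rot_to[i r def_s].
have pr : perm_eq (r ++ [:: a]) s.
  by rewrite perm_catC /= -def_s perm_rot.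
exists (r ++ [:: a]) => //.
have -> : next s a = head a r.
  by rewrite -(next_rot i us) def_s; case: (r) => /= *; rewrite eqxx.
move: cs; rewrite -(rot_cycle i) def_s /= rcons_path.
case: r {def_s pr} => [|c r] /= ; first by rewrite /walk /= !eqxx.
by case/andP=> /andP[_ pc] la; rewrite /walk /= eqxx cats1 rcons_path pc la last_rcons eqxx.
Qed.

(** Both arcs together are a rotation of [s], which is why successors may be computed in [p ++ q] as
    well as in [s]. *)
Lemma cut2 s a b : cycle e s -> uniq s -> a \in s -> b \in s -> a != b ->
  exists p q, [/\ perm_eq (p ++ q) s, next (p ++ q) =1 next s,
                  walk (next s a) b p & walk (next s b) a q].
Proof.
move=> cs us sa sb nab; have [i r def_s] := rot_to sa.
have rb : b \in r.
  by move: sb; rewrite -(mem_rot i) def_s inE eq_sym (negPf nab).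
case/splitPr: rb def_s => p1 p2 def_s.
have nx_a : next s a = head b p1.
  by rewrite -(next_rot i us) def_s; case: (p1) => [|c p] /=; rewrite eqxx.
have nx_b : next s b = head a p2.
  rewrite -(next_rot i us) def_s.
  have us' : uniq (a :: p1 ++ b :: p2) by rewrite -def_s rot_uniq.
  rewrite -(next_rot (size (a :: p1)) us') -cat_cons rot_size_cat /=.
  by case: (p2) => [|c p] /=; rewrite eqxx.
move: cs; rewrite -(rot_cycle i) def_s /= rcons_path cat_path /= last_cat /=.
case/andP=> /and3P[pp1 lb pp2] la.
have def_r : (p1 ++ [:: b]) ++ (p2 ++ [:: a]) = rot 1 (rot i s).
  by rewrite def_s rot1_cons -cats1 -!catA.
exists (p1 ++ [:: b]), (p2 ++ [:: a]); split.
- by rewrite def_r !perm_rot.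
- by move=> z; rewrite def_r !next_rot // rot_uniq.
- rewrite nx_a; case: (p1) pp1 lb => [|c p] /=; first by rewrite walk1.
  move=> /andP[_ pc] lb.
  by rewrite /walk eqxx cats1 rcons_path pc lb last_rcons eqxx.
- rewrite nx_b; case: (p2) pp2 la => [|c p] /=; first by rewrite walk1.
  move=> /andP[_ pc] la.
  by rewrite /walk eqxx cats1 rcons_path pc la last_rcons eqxx.
Qed.

(** Serves to drop the first vertex of an arc of a cut cycle. Taking [next] in the whole list
    identifies the new start as a second successor on that cycle. *)
Lemma walk_behead p x a q r : uniq (p ++ q ++ r) -> walk x a q -> x != a ->
  exists2 q', q = x :: q' & walk (next (p ++ q ++ r) x) a q'.
Proof.
case: q => // y q u /and3P[/eqP eyx py /eqP ly] nxa; rewrite eyx in py ly u *.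
exists q => //; case: q py ly u => [|c q] /=; first by move=> _ xa; rewrite xa eqxx in nxa.
by case/andP=> _ pc lc u; rewrite next_mid // /walk eqxx pc lc eqxx.
Qed.

Lemma next_neq s a : cycle e s -> a \in s -> next s a != a.
Proof.
by move=> cs sa; apply/eqP=> E; have := next_cycle cs sa; rewrite E e_irr.
Qed.

Lemma next_inj (s : seq T) : uniq s -> injective (next s).
Proof. by move/prev_next; exact: can_inj. Qed.

Lemma cycle_insert s w W u : cycle e s -> uniq s -> u \in s ->
  path e w W -> uniq (w :: W) -> ~~ has (mem s) (w :: W) ->
  e u w -> e (last w W) (next s u) ->
  exists2 s', cycle e s' & uniq s' /\ perm_eq s' (s ++ w :: W).
Proof.
move=> cs us su pW uW dW euw el.
have [p pp wp] := cut1 cs us su.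
exists (p ++ w :: W).
  exact: walk_cycle (walk_cat wp euw (walk_path pW)) el.
have pe : perm_eq (p ++ w :: W) (s ++ w :: W) by rewrite perm_cat2r.
by split=> //; rewrite (perm_uniq pe) cat_uniq us dW uW.
Qed.

(** The new cycle runs backwards along the arc from [u'] to [next s u], crosses to [next s u'],
    follows the other arc to [u], and returns to [u'] through [w :: W]. *)
Lemma cycle_cross s w W u u' : cycle e s -> uniq s -> u \in s -> u' \in s ->
  u != u' -> path e w W -> uniq (w :: W) -> ~~ has (mem s) (w :: W) ->
  e u w -> e (last w W) u' -> e (next s u) (next s u') ->
  exists2 s', cycle e s' & uniq s' /\ perm_eq s' (s ++ w :: W).
Proof.
move=> cs us su su' nuu pW uW dW euw el en.
have [p [q [pp _ wp wq]]] := cut2 cs us su su' nuu.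
exists (rev p ++ q ++ w :: W).
  exact: walk_cycle (walk_cat (walk_rev wp) en (walk_cat wq euw (walk_path pW))) el.
have pe : perm_eq (rev p ++ q ++ w :: W) (s ++ w :: W).
  by rewrite catA perm_cat2r -(permPr pp) perm_cat2r perm_rev.
by split=> //; rewrite (perm_uniq pe) cat_uniq us dW uW.
Qed.

End Walks.

(** * Independent sets, cliques and elementary counting *)

Section Independence.
Variables (T : finType) (e : rel T).
Hypotheses (e_sym : symmetric e) (e_irr : irreflexive e).

Definition indep (I : {set T}) : bool := [forall x in I, forall y in I, ~~ e x y].

Definition clique (Q : {set T}) : bool :=
  [forall x in Q, forall y in Q, (x != y) ==> e x y].

Definition alpha (A : {set T}) : nat :=
  \max_(I : {set T} | (I \subset A) && indep I) #|I|.

Lemma indepP (I : {set T}) :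
  reflect (forall x y, x \in I -> y \in I -> ~~ e x y) (indep I).
Proof.
apply: (iffP forall_inP) => [H x y Ix Iy|H x Ix].
  exact: (forall_inP (H x Ix)).
by apply/forall_inP => y Iy; exact: H.
Qed.

Lemma cliqueP (Q : {set T}) :
  reflect (forall x y, x \in Q -> y \in Q -> x != y -> e x y) (clique Q).
Proof.
apply: (iffP forall_inP) => [H x y Qx Qy nxy|H x Qx].
  by have := forall_inP (H x Qx) y Qy; rewrite nxy.
by apply/forall_inP => y Qy; apply/implyP; exact: H.
Qed.

Lemma indep_sub (I J : {set T}) : I \subset J -> indep J -> indep I.
Proof.
move=> /subsetP IJ /indepP H; apply/indepP => x y /IJ Jx /IJ Jy; exact: H.
Qed.

Lemma indep0 : indep set0.
Proof. by apply/indepP => x y; rewrite inE. Qed.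

Lemma indep1 x : indep [set x].
Proof. by apply/indepP => y z /set1P-> /set1P->; rewrite e_irr. Qed.

Lemma indepU (I J : {set T}) : indep I -> indep J ->
  (forall x y, x \in I -> y \in J -> ~~ e x y) -> indep (I :|: J).
Proof.
move=> /indepP iI /indepP iJ H; apply/indepP => x y /setUP[] ? /setUP[] ?;
  by [exact: iI | exact: iJ | exact: H | rewrite e_sym; exact: H].
Qed.

Lemma indep2 x y : ~~ e x y -> indep [set x; y].
Proof.
by move=> nxy; apply: indepU; rewrite ?indep1 // => a b /set1P-> /set1P->.
Qed.

Lemma indep3 x y z : ~~ e x y -> ~~ e x z -> ~~ e y z -> indep [set x; y; z].
Proof.
move=> *; apply: indepU; rewrite ?indep1 ?indep2 // => a b.
by case/set2P=> -> /set1P->.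
Qed.

Lemma alpha_max (A I : {set T}) : I \subset A -> indep I -> #|I| <= alpha A.
Proof. by move=> sIA iI; apply: (bigmax_sup I); rewrite ?sIA. Qed.

Lemma alpha_leP (A : {set T}) k :
  reflect (forall I : {set T}, I \subset A -> indep I -> #|I| <= k) (alpha A <= k).
Proof.
rewrite /alpha; apply: (iffP (bigmax_leqP _ _ _)) => [H I sIA iI|H I /andP[sIA iI]]; last exact: H.
by apply: H; rewrite sIA.
Qed.

Lemma alpha_witness (A : {set T}) :
  exists I : {set T}, [/\ I \subset A, indep I & #|I| = alpha A].
Proof.
have [|I] := @eq_bigmax_cond _ [pred I : {set T} | (I \subset A) && indep I] (fun I => #|I|).
  by apply/card_gt0P; exists set0; rewrite inE sub0set indep0.
by rewrite inE => /andP[sIA iI] aE; exists I; split; rewrite // -aE.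
Qed.

Lemma alphaS (A B : {set T}) : A \subset B -> alpha A <= alpha B.
Proof.
move=> sAB; apply/alpha_leP => I sIA; apply: alpha_max; exact: subset_trans sAB.
Qed.

Lemma cardU_disj (A B : {set T}) :
  (forall x, x \in A -> x \notin B) -> #|A :|: B| = #|A| + #|B|.
Proof.
move=> H; rewrite cardsU (_ : A :&: B = set0) ?cards0 ?subn0 //.
by apply/setP=> z; rewrite !inE; case: (boolP (z \in A)) => // /H/negPf->.
Qed.

Lemma subset_card (A : {set T}) m : m <= #|A| ->
  exists2 B : {set T}, B \subset A & #|B| = m.
Proof.
move=> le_m; exists [set x in take m (enum A)].
  by apply/subsetP=> x; rewrite inE => /mem_take; rewrite mem_enum.
rewrite cardsE (card_uniqP _) ?take_uniq ?enum_uniq // size_take_min -cardE.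
exact/minn_idPl.
Qed.

Lemma superset_card (A B : {set T}) m : A \subset B -> #|A| <= m <= #|B| ->
  exists X : {set T}, [/\ A \subset X, X \subset B & #|X| = m].
Proof.
move=> sAB /andP[le1 le2].
have [|C sC cC] := @subset_card (B :\: A) (m - #|A|).
  by rewrite cardsD (setIidPr sAB); lia.
exists (A :|: C); split; rewrite ?subsetUl //.
  by rewrite subUset sAB (subset_trans sC) // subsetDl.
rewrite cardU_disj ?cC; first by lia.
by move=> x Ax; apply/negP => /(subsetP sC); rewrite inE Ax.
Qed.

(** Double counting of the edges between [J] and [X]. *)
Lemma card_cover (X J : {set T}) c :
  (forall u, u \in X -> exists2 x, x \in J & e x u) ->
  (forall x, x \in J -> #|[set u in X | e x u]| <= c) -> #|X| <= #|J| * c.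
Proof.
move=> cov bnd; rewrite -sum1_card.
apply: (@leq_trans (\sum_(u in X) \sum_(x in J | e x u) 1)).
  apply: leq_sum => u /cov[x Jx exu].
  by rewrite (bigD1 x) ?Jx //= ?exu ?leq_addr.
rewrite (exchange_big_dep (mem J)) /=; last by move=> u x _ /andP[].
rewrite -sum_nat_const; apply: leq_sum => x Jx.
apply: leq_trans (bnd x Jx); rewrite -sum1_card.
by apply/eq_leq/eq_bigl => u; rewrite inE Jx.
Qed.

Lemma clique_path (Q : {set T}) x s : clique Q -> uniq (x :: s) ->
  {subset x :: s <= Q} -> path e x s.
Proof.
move=> /cliqueP cQ; elim: s x => //= y s IH x /andP[]; rewrite inE negb_or.
move=> /andP[nxy _] uys sQ; rewrite cQ ?sQ ?inE ?eqxx ?orbT //=.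
by apply: IH => // z zs; rewrite sQ // inE zs orbT.
Qed.

Lemma clique_walk (Q : {set T}) a m : clique Q -> a \in Q -> 0 < m <= #|Q| ->
  exists b s, [/\ walk e a b s, uniq s, {subset s <= Q}, size s = m & m = 1 \/ a != b].
Proof.
move=> cQ Qa /andP[m0 mQ].
have [|B sB cB] := @subset_card (Q :\ a) m.-1.
  by move: mQ; rewrite (cardsD1 a Q) Qa; lia.
have uB : uniq (a :: enum B).
  rewrite /= enum_uniq andbT mem_enum; apply/negP => /(subsetP sB).
  by rewrite !inE eqxx.
have sQ : {subset a :: enum B <= Q}.
  move=> z; rewrite inE mem_enum => /orP[/eqP->//|/(subsetP sB)].
  by rewrite !inE => /andP[].
exists (last a (enum B)), (a :: enum B); split=> //.
- exact: walk_path (clique_path cQ uB sQ).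
- by rewrite /= -cardE cB; lia.
- case E: (enum B) => [|c s]; last right.
    by left; have := f_equal size E; rewrite -cardE cB /=; lia.
  by apply/negP => /eqP /= ab; move: uB; rewrite E /= {1}ab mem_last.
Qed.

End Independence.

(** * Disjoint red cliques of size [n - 1] and greedy choices from them *)

Section CliqueSystems.
Variables (T : finType) (e : rel T).
Hypotheses (e_sym : symmetric e) (e_irr : irreflexive e).
Variable n : nat.
Hypothesis noC : forall s, cycle e s -> uniq s -> size s <> n.

Local Notation indep := (indep e).
Local Notation clique := (clique e).
Local Notation alpha := (alpha e).

(** Indexing by natural numbers lets the greedy choice run over an arbitrary list of indices. *)
Definition clique_system (A : {set T}) (k : nat) (Q : nat -> {set T}) : Prop :=
  (forall i, i < k -> [/\ Q i \subset A, clique (Q i) & #|Q i| = n - 1]) /\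
  (forall i j x, i < k -> j < k -> x \in Q i -> x \in Q j -> i = j).

(** Two neighbours [a], [b] of [v] in [Q] would close a [C_n]: a Hamiltonian path of [Q] from [a] to
    [b], then [v]. *)
Lemma nbr_clique_le1 (Q : {set T}) v : 1 < n -> clique Q -> #|Q| = n - 1 ->
  v \notin Q -> #|[set x in Q | e v x]| <= 1.
Proof.
move=> n1 cQ sQ nQv; rewrite leqNgt; apply/negP => /card_gt1P[a [b []]].
rewrite !inE => /andP[Qa eva] /andP[Qb evb] nab.
pose s := rcons (enum (Q :\ a :\ b)) b.
have us : uniq (a :: s).
  by rewrite /= rcons_uniq mem_rcons enum_uniq inE !mem_enum !inE !eqxx (negPf nab).
have sub : {subset a :: s <= Q}.
  move=> z; rewrite inE mem_rcons inE mem_enum !inE.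
  by case/or3P=> [/eqP->|/eqP->|/and3P[]].
have ps : path e a s := clique_path cQ us sub.
apply: (noC (s := v :: a :: s)).
- by rewrite /= rcons_path eva ps /= last_rcons e_sym.
- by rewrite cons_uniq us andbT; apply/negP => /sub; rewrite (negPf nQv).
- have := cardsD1 a Q; have := cardsD1 b (Q :\ a).
  rewrite !inE Qa Qb eq_sym nab /= size_rcons -cardE; lia.
Qed.

(** By [nbr_clique_le1] every vertex already chosen spoils at most one candidate in each later
    clique, so candidate sets at least as large as the final set never run out. *)
Lemma greedy_transversal (Q S : nat -> {set T}) (s : seq nat) (I0 : {set T}) :
  1 < n -> uniq s -> indep I0 ->
  (forall i, i \in s -> [/\ clique (Q i), #|Q i| = n - 1 & S i \subset Q i]) ->
  (forall i j x, i \in s -> j \in s -> x \in Q i -> x \in Q j -> i = j) ->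
  (forall i x, i \in s -> x \in I0 -> x \notin Q i) ->
  (forall i, i \in s -> #|I0| + size s <= #|S i|) ->
  exists I : {set T}, [/\ indep I, #|I| = #|I0| + size s &
    forall x, x \in I -> x \in I0 \/ exists2 i, i \in s & x \in S i].
Proof.
move=> n1; elim: s I0 => [|i s IH] I0 us iI0 HQ HD H0 Hc.
  by exists I0; rewrite addn0; split=> // x; left.
have [cQ sQ SQ] := HQ i (mem_head _ _).
pose F := [set x in S i | [exists v in I0, e v x]].
have leF : #|F| <= #|I0| * 1.
  apply: (card_cover (e := e)) => [u|v I0v].
    by rewrite !inE => /andP[_ /exists_inP[v Iv evu]]; exists v.
  apply: leq_trans (nbr_clique_le1 n1 cQ sQ (H0 i v (mem_head _ _) I0v)).
  apply: subset_leq_card; apply/subsetP => u; rewrite !inE.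
  by case/andP=> /andP[/(subsetP SQ)-> _] ->.
have [x Sx nFx] : exists2 x, x \in S i & x \notin F.
  apply/subsetPn; apply/negP => /subset_leq_card.
  have := Hc i (mem_head _ _); rewrite /=; lia.
have nI0x : x \notin I0.
  apply/negP => Ix; have := H0 i x (mem_head _ _) Ix.
  by rewrite (subsetP SQ).
have nadj v : v \in I0 -> ~~ e v x.
  move=> Iv; apply/negP => evx; case/negP: nFx; rewrite inE Sx.
  by apply/exists_inP; exists v.
have cU : #|x |: I0| = #|I0|.+1 by rewrite cardsU1 nI0x.
have [/= nis us'] := andP us.
have [|j js|j k y js ks|j y js|j js|I [iI cI HI]] := IH (x |: I0) us'.
- apply: indepU => //; first exact: indep1.
  by move=> a b /set1P-> Ib; rewrite e_sym nadj.
- by apply: HQ; rewrite inE js orbT.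
- by apply: HD; rewrite inE ?js ?ks orbT.
- case/setU1P => [->|I0y]; last by apply: H0; rewrite // inE js orbT.
  apply/negP => Qjx; have ij : i = j.
    by apply: (HD i j x); rewrite ?inE ?eqxx ?js ?orbT // (subsetP SQ).
  by rewrite ij js in nis.
- by have := Hc j; rewrite inE js orbT cU /= => /(_ isT); lia.
exists I; split=> //; first by rewrite cI cU /=; lia.
move=> y /HI[/setU1P[->|]|[j js Sy]]; [right|left|right] => //.
  by exists i; rewrite ?mem_head.
by exists j; rewrite // inE js orbT.
Qed.

(** The greedy choice, started at [v], adds one vertex from each of the [k] cliques. *)
Lemma clique_system_extra (A B : {set T}) k Q v : 1 < n -> k.+1 < n ->
  B \subset A -> clique_system B k Q -> v \in A -> v \notin B -> k < alpha A.
Proof.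
move=> n1 kn sBA [HQ HD] Av nBv.
have [|i||i x|i|I [iI cI HI]] := @greedy_transversal Q Q (iota 0 k) [set v] n1 (iota_uniq _ _).
- exact: indep1.
- by rewrite mem_iota => /andP[_ /HQ[]].
- by move=> i j x; rewrite !mem_iota => /andP[_ ik] /andP[_ jk]; exact: HD.
- rewrite mem_iota => /andP[_ /HQ[sQ _ _]] /set1P->.
  by apply: contra nBv; exact: subsetP.
- by rewrite mem_iota => /andP[_ /HQ[_ _ ->]]; rewrite cards1 size_iota; lia.
have -> : k.+1 = #|I| by rewrite cI cards1 size_iota.
apply: alpha_max => //; apply/subsetP=> x /HI[/set1P->//|[i]].
by rewrite mem_iota => /andP[_ /HQ[sQ _ _]] /(subsetP sQ); exact: subsetP.
Qed.

(** Two non-adjacent vertices of [X], completed greedily in the [k] cliques, would be [k + 2]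
    independent vertices; hence [X] is itself a clique and joins the system. *)
Lemma clique_system_add (A X : {set T}) k Q : 1 < n -> k.+2 < n ->
  X \subset A -> #|X| = n - 1 -> clique_system (A :\: X) k Q ->
  alpha A <= k.+1 -> exists Q', clique_system A k.+1 Q'.
Proof.
move=> n1 kn sXA cX [HQ HD] aA.
have clX : clique X.
  apply/cliqueP => w w' Xw Xw' nww; apply/idPn => neww.
  have cw : #|[set w; w']| = 2 by rewrite cards2 nww.
  have [|i||i x|i|I [iI cI HI]] := @greedy_transversal Q Q (iota 0 k) [set w; w'] n1 (iota_uniq _ _).
  - exact: indep2.
  - by rewrite mem_iota => /andP[_ /HQ[]].
  - by move=> i j x; rewrite !mem_iota => /andP[_ ik] /andP[_ jk]; exact: HD.
  - rewrite mem_iota => /andP[_ /HQ[sQ _ _]] w2x; apply/negP => /(subsetP sQ).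
    by rewrite inE; case/set2P: w2x => ->; rewrite ?Xw ?Xw'.
  - by rewrite mem_iota => /andP[_ /HQ[_ _ ->]]; rewrite cw size_iota; lia.
  have: #|I| <= k.+1.
    apply: leq_trans aA; apply: alpha_max => //; apply/subsetP=> x /HI[|[i]].
      by case/set2P=> ->; apply: (subsetP sXA).
    rewrite mem_iota => /andP[_ /HQ[sQ _ _]] /(subsetP sQ).
    by rewrite inE => /andP[].
  by rewrite cI cw size_iota; lia.
exists (fun i => if i == k then X else Q i); split=> [i|i j x].
  rewrite ltnS leq_eqVlt => /orP[/eqP->|ik]; first by rewrite eqxx.
  rewrite ltn_eqF //; have [sQ cQ nQ] := HQ i ik; split=> //.
  exact: subset_trans sQ (subsetDl _ _).
have H l : l < k -> x \in X -> x \in Q l -> False.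
  by move=> /HQ[sQ _ _] Xx /(subsetP sQ); rewrite inE Xx.
rewrite ltnS (leq_eqVlt i) ltnS (leq_eqVlt j).
move=> /orP[/eqP->|ik] /orP[/eqP->|jk]; rewrite ?eqxx ?(ltn_eqF ik) ?(ltn_eqF jk) //.
- by move=> Xx /(H _ jk Xx).
- by move=> Qx /H-/(_ _ ik Qx).
- exact: HD.
Qed.

End CliqueSystems.

(** * The case in which deleting [n - 1] vertices never lowers the independence number *)

Section Dominated.
Variables (T : finType) (e : rel T).
Hypotheses (e_sym : symmetric e) (e_irr : irreflexive e).
Variables (n k : nat) (A : {set T}).
Hypothesis noC : forall s, cycle e s -> uniq s -> size s <> n.
Hypothesis n_ge24 : 24 <= n.
Hypothesis n_ge : k * (k - 2) <= n.
Hypothesis alphaA : alpha e A <= k.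
Hypothesis dom_set : forall X : {set T}, #|X| <= n - 1 ->
  exists J : {set T}, [/\ J \subset A :\: X, indep e J & #|J| = k].

Local Notation indep := (indep e).
Local Notation clique := (clique e).
Local Notation alpha := (alpha e).
Local Notation nbrs x D := [set u in D | e x u].

Lemma indep_leq (I : {set T}) : I \subset A -> indep I -> #|I| <= k.
Proof. by move=> sIA iI; apply: leq_trans alphaA; exact: alpha_max. Qed.

Lemma dominates (J : {set T}) u : J \subset A -> indep J -> #|J| = k ->
  u \in A -> u \notin J -> exists2 x, x \in J & e x u.
Proof.
move=> sJ iJ cJ Au nJu; apply/exists_inP; apply: contraT.
rewrite negb_exists_in => /forall_inP H.
have : #|u |: J| <= k.
  apply: indep_leq; first by rewrite subUset sub1set Au.
  apply: indepU => //; first exact: indep1.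
  by move=> x y /set1P-> Jy; rewrite e_sym H.
by rewrite cardsU1 nJu cJ; lia.
Qed.

(** Otherwise [x] and its neighbours are at most [n - 1] vertices, and an independent [k]-set
    avoiding them all would have to dominate [x]. *)
Lemma min_degree x : x \in A -> n - 1 <= #|nbrs x A|.
Proof.
move=> Ax; rewrite leqNgt; apply/negP => lt.
have [|J [sJ iJ cJ]] := dom_set (X := x |: nbrs x A).
  by rewrite cardsU1; case: (_ \notin _) => /=; lia.
have sJA : J \subset A := subset_trans sJ (subsetDl _ _).
have nJx : x \notin J by apply/negP => /(subsetP sJ); rewrite !inE eqxx.
have [y Jy] := dominates sJA iJ cJ Ax nJx.
rewrite e_sym => exy; have := subsetP sJ y Jy.
by rewrite !inE exy (subsetP sJA) // orbT.
Qed.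

Lemma card_next (s : seq T) (D : {set T}) : uniq s -> #|next s @: D| = #|D|.
Proof. by move=> us; apply: card_imset; exact: next_inj. Qed.

(** Either adjacency would let [x] be absorbed, by insertion after [u] or by a crossing at [u] and
    [u']. *)
Lemma not_extendable s x : cycle e s -> uniq s -> x \notin s ->
  (forall s', cycle e s' -> uniq s' -> perm_eq s' (s ++ [:: x]) -> False) ->
  (forall u, u \in s -> e x u -> ~~ e x (next s u)) /\
  (forall u u', u \in s -> u' \in s -> e x u -> e x u' ->
     ~~ e (next s u) (next s u')).
Proof.
move=> cs us nx H.
have dx : ~~ has (mem s) [:: x] by rewrite /= orbF.
split=> [u su xu|u u' su su' xu xu']; apply/negP => en.
  have eux : e u x by rewrite e_sym.
  have [s' cs' [us' ps']] := cycle_insert (W := [::]) cs us su isT isT dx eux en.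
  exact: H ps'.
have [uu|nuu] := eqVneq u u'; first by rewrite uu e_irr in en.
have eux : e u x by rewrite e_sym.
have [s' cs' [us' ps']] :=
  cycle_cross (W := [::]) e_sym cs us su su' nuu isT isT dx eux xu' en.
exact: H ps'.
Qed.

Lemma not_extendable_degree s x : cycle e s -> uniq s ->
  {subset s <= A} -> x \in A -> x \notin s ->
  (forall s', cycle e s' -> uniq s' -> perm_eq s' (s ++ [:: x]) -> False) ->
  #|[set u in s | e x u]| < k.
Proof.
move=> cs us sA Ax nx H; have [H1 H2] := not_extendable cs us nx H.
set D0 := [set u in s | e x u].
have mD u : u \in D0 -> u \in s /\ e x u by rewrite inE => /andP.
have sub : x |: next s @: D0 \subset A.
  rewrite subUset sub1set Ax; apply/subsetP => _ /imsetP[u /mD[su _] ->].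
  by rewrite sA // mem_next.
have: #|x |: next s @: D0| <= k.
  apply: indep_leq => //; apply: indepU; rewrite ?indep1 //.
    apply/indepP => _ _ /imsetP[u /mD[su xu] ->] /imsetP[v /mD[sv xv] ->].
    exact: H2.
  by move=> _ _ /set1P-> /imsetP[u /mD[su xu] ->]; exact: H1.
rewrite cardsU1 card_next //.
suff -> : x \notin next s @: D0 by [].
by apply/negP => /imsetP[u /mD[su _] E]; rewrite E mem_next su in nx.
Qed.

(* Vertices of [B] followed on the cycle by a vertex of [B] have their
   successors in [B], so each dominating vertex sees at most [a] of them. *)
Lemma dense_cycle (B : {set T}) a s :
  (forall I : {set T}, I \subset B -> indep I -> #|I| <= a) ->
  n + k * a <= 2 * #|B| -> cycle e s -> uniq s -> {subset s <= A} ->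
  {subset B <= s} -> size s < n -> False.
Proof.
(* Induction on [n - size s]: a cycle that absorbs one more vertex either has the forbidden length
   [n] or falls under the induction hypothesis. *)
move=> aB le_B; move: {2}(n - size s) (leqnn (n - size s)) => N.
elim: N s => [|N IH] s leN cs us sA sB lt; first by lia.
have cX : #|[set x in s]| = size s by rewrite cardsE; exact/card_uniqP.
have [|J [sJ iJ cJ]] := dom_set (X := [set x in s]); first by rewrite cX; lia.
have sJA : J \subset A := subset_trans sJ (subsetDl _ _).
have nJ x : x \in J -> x \notin s.
  by move/(subsetP sJ); rewrite !inE => /andP[].
have noext x : x \in J ->
  forall s', cycle e s' -> uniq s' -> perm_eq s' (s ++ [:: x]) -> False.
  move=> Jx s' cs' us' ps'.
  have sz : size s' = (size s).+1 by rewrite (perm_size ps') size_cat addn1.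
  have [E|nE] := eqVneq (size s') n; first exact: noC cs' us' E.
  have lt' : size s' < n by move: sz lt nE; clear; lia.
  have leN' : n - size s' <= N by move: sz leN; clear; lia.
  apply: (IH s' leN' cs' us' _ _ lt').
    move=> z; rewrite (perm_mem ps') mem_cat inE => /orP[/sA//|/eqP->].
    exact: (subsetP sJA).
  by move=> z /sB sz'; rewrite (perm_mem ps') mem_cat sz'.
pose B0 := [set u in B | next s u \in B].
(* [next s] maps [B :\: B0] injectively into the part of the cycle outside [B]. *)
have cB0 : #|B| <= #|B0| + (size s - #|B|).
  have sBs : B \subset [set x in s] by apply/subsetP => z /sB; rewrite inE.
  have E1 : #|[set x in s] :\: B| = size s - #|B|.
    by rewrite cardsD (setIidPr sBs) cX.
  have sB0 : B0 \subset B by apply/subsetP => z; rewrite inE => /andP[].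
  have E2 : #|B :\: B0| = #|B| - #|B0| by rewrite cardsD (setIidPr sB0).
  have : #|B :\: B0| <= #|[set x in s] :\: B|.
    rewrite -(card_next (B :\: B0) us); apply: subset_leq_card.
    apply/subsetP => y /imsetP[u]; rewrite in_setD => /andP[nB0 Bu] ->.
    rewrite in_setD inE mem_next sB // andbT.
    by apply: contra nB0 => nB; rewrite inE Bu.
  have := subset_leq_card sB0; lia.
(* Together with [cB0] this gives [2 * #|B| <= size s + k * a < n + k * a], contrary to [le_B]. *)
have: #|B0| <= #|J| * a.
  apply: (card_cover (e := e)) => [u|x Jx].
    rewrite inE => /andP[Bu _]; have su := sB _ Bu.
    apply: dominates => //; first exact: sA.
    by apply/negP => /nJ; rewrite su.
  have [_ H2] := not_extendable cs us (nJ x Jx) (noext x Jx).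
  rewrite -(card_next _ us); apply: aB.
    apply/subsetP => y /imsetP[u]; rewrite !inE => /andP[/andP[_ Bn] _] ->.
    exact: Bn.
  apply/indepP => y z /imsetP[u + ->] /imsetP[v + ->].
  rewrite !inE => /andP[/andP[/sB su _] xu] /andP[/andP[/sB sv _] xv].
  exact: H2.
have : #|B| <= size s.
  by rewrite -cX; apply: subset_leq_card; apply/subsetP => z /sB; rewrite inE.
rewrite cJ; lia.
Qed.

(** A Hamiltonian cycle of [Q] meets the conditions of [dense_cycle] with [a = 1], since
    [n + k <= 2 * (n - 1)]. *)
Lemma no_big_clique (Q : {set T}) : Q \subset A -> clique Q -> #|Q| = n - 1 ->
  k <= n - 2 -> False.
Proof.
move=> sQ cQ nQ kn.
have [a Qa] : exists a, a \in Q by apply/card_gt0P; lia.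
have [|b [s [ws us sQs szs]]] := clique_walk (m := n - 1) cQ Qa; first by lia.
case=> [|nab]; first by lia.
have wb : b \in Q.
  by apply: sQs; case: s ws {us szs} => // c s /and3P[_ _ /eqP<-]; exact: mem_last.
apply: (@dense_cycle Q 1 s) => //.
- move=> I sI /indepP iI; rewrite leqNgt; apply/negP => /card_gt1P[x [y [Ix Iy nxy]]].
  by have := iI x y Ix Iy; rewrite (cliqueP _ _ cQ) // (subsetP sI).
- by rewrite nQ; lia.
- by apply: walk_cycle ws _; apply: (cliqueP _ _ cQ) => //; rewrite eq_sym.
- by move=> z /sQs; exact: (subsetP sQ).
- have E : s =i Q by apply: (subset_cardP _ _); [rewrite (card_uniqP us) szs nQ | exact/subsetP].
  by move=> z; rewrite E.
- by rewrite szs; lia.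
Qed.

(** * Chords, cycle lengths and short connecting paths *)

Lemma chord (s : seq T) : uniq s -> {subset s <= A} -> 2 * k < size s ->
  exists s1 a s2 b s3,
    [/\ s = s1 ++ a :: s2 ++ b :: s3, e a b, 0 < size s2 & size s2 < 2 * k].
Proof.
case: s => // x0 s0; set s := x0 :: s0 => us sA sz.
(* The [k + 1] vertices at even positions up to [2 * k] cannot be independent; even spacing leaves
   at least one vertex between the ends of the chord. *)
pose f (t : 'I_k.+1) := nth x0 s (2 * t).
have lt2 (t : 'I_k.+1) : 2 * t < size s by have := ltn_ord t; lia.
have f_inj : injective f.
  move=> t t' /eqP; rewrite nth_uniq // => /eqP E; apply: val_inj => /=; lia.
pose I := f @: [set: 'I_k.+1].
have cI : #|I| = k.+1 by rewrite card_imset // cardsT card_ord.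
have nI : ~~ indep I.
  apply/negP => iI; suff : #|I| <= k by lia.
  apply: indep_leq => //; apply/subsetP => y /imsetP[t _ ->].
  by apply: sA; rewrite mem_nth.
have [i [j [lt_ij lt_j eij]]] : exists i j, [/\ i.+1 < j, j <= 2 * k & e (nth x0 s i) (nth x0 s j)].
  move: nI; rewrite negb_forall_in => /exists_inP[y /imsetP[t _ ->]].
  rewrite negb_forall_in => /exists_inP[z /imsetP[t' _ ->]].
  rewrite negbK => ef; have := ltn_ord t; have := ltn_ord t' => l l'.
  have [lt|lt|E] := ltngtP t t'.
  - by exists (2 * t), (2 * t'); split=> //; lia.
  - by exists (2 * t'), (2 * t); split=> //; rewrite 1?e_sym //; lia.
  - by rewrite (val_inj E) e_irr in ef.
exists (take i s), (nth x0 s i), (take (j - i.+1) (drop i.+1 s)), (nth x0 s j), (drop j.+1 s).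
have sz' : size (take (j - i.+1) (drop i.+1 s)) = j - i.+1.
  rewrite size_take_min size_drop; lia.
split=> //; rewrite ?sz'; try lia.
have lt_is : i < size s by lia.
have lt_js : j < size s by lia.
rewrite -{1}(cat_take_drop i s) (drop_nth x0) //; congr (_ ++ _ :: _).
rewrite -{1}(cat_take_drop (j - i.+1) (drop i.+1 s)) drop_drop subnK; last by lia.
by rewrite (drop_nth x0 lt_js).
Qed.

Lemma split_last (a : pred T) p : has a p ->
  exists p1 y p2, [/\ p = p1 ++ y :: p2, a y & ~~ has a p2].
Proof.
elim: p => //= z p IH; have [/IH[p1 [y [p2 [-> ay np]]]] _|np] := boolP (has a p).
  by exists (z :: p1), y, p2.
by rewrite orbF => az; exists [::], z, p.
Qed.

(** When the path cannot be extended at its start [x], all neighbours of [x], at least [n - 1] of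
    them, lie on it. Closing it at the last of them gives a cycle through [x] and all its
    neighbours. *)
Lemma long_cycle x0 : x0 \in A ->
  exists s, [/\ cycle e s, uniq s, {subset s <= A} & n <= size s].
Proof.
move=> Ax0.
suff H N x p : path e x p -> uniq (x :: p) -> {subset x :: p <= A} ->
    #|A| - size p <= N ->
    exists s, [/\ cycle e s, uniq s, {subset s <= A} & n <= size s].
  by apply: (H #|A| x0 [::]) => //=; [move=> z /[!inE] /eqP-> | lia].
elim: N x p => [|N IH] x p pp up sp leN.
  have : size (x :: p) <= #|A|.
    by rewrite -(card_uniqP up); apply: subset_leq_card; exact/subsetP.
  by rewrite /=; lia.
have Ax : x \in A by apply: sp; exact: mem_head.
have [/exists_inP[y Ay /andP[exy ny]]|/exists_inPn max_p] :=
  boolP [exists y in A, e x y && (y \notin x :: p)].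
  apply: (IH y (x :: p)); rewrite /= 1?e_sym ?exy //.
  - by rewrite ny.
  - by move=> z /[!inE] /orP[/eqP->|] //; apply: sp.
  - have : size (x :: p) <= #|A|.
      by rewrite -(card_uniqP up); apply: subset_leq_card; exact/subsetP.
    by rewrite /=; lia.
have xp y : y \in A -> e x y -> y \in p.
  move=> Ay exy; have := max_p y Ay; rewrite exy negbK inE.
  by case/orP=> // /eqP E; rewrite E e_irr in exy.
pose N0 := nbrs x A; have degx := min_degree Ax.
have hasp : has (e x) p.
  have [y] : exists y, y \in N0 by apply/card_gt0P; rewrite /N0; lia.
  by rewrite inE => /andP[Ay exy]; apply/hasP; exists y; rewrite ?xp.
have [p1 [y [p2 [def_p exy np2]]]] := split_last hasp.
have sub0 : N0 \subset y :: p1.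
  apply/subsetP => z; rewrite !inE => /andP[Az exz].
  have := xp z Az exz; rewrite def_p mem_cat inE.
  case/or3P=> [->|->//|p2z]; first by rewrite orbT.
  by case/negP: np2; apply/hasP; exists z.
have u1 : uniq (x :: rcons p1 y).
  by move: up; rewrite def_p -cat_rcons -cat_cons cat_uniq => /andP[].
exists (x :: rcons p1 y); split=> //.
- rewrite /= rcons_path last_rcons e_sym exy andbT.
  by move: pp; rewrite def_p -cat_rcons cat_path => /andP[].
- move=> z zin; apply: sp; rewrite def_p -cat_rcons -cat_cons mem_cat zin //.
- have : #|N0| <= (size p1).+1.
    exact: leq_trans (subset_leq_card sub0) (card_size (y :: p1)).
  by rewrite /= size_rcons; move: degx; rewrite -/N0; clear; lia.
Qed.

Lemma cycle_shorten s : cycle e s -> uniq s -> {subset s <= A} ->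
  2 * k < size s ->
  exists s', [/\ cycle e s', uniq s', {subset s' <= A}, size s' < size s &
                 size s < size s' + 2 * k].
Proof.
move=> cs us sA sz; have [s1 [a [s2 [b [s3 [def_s eab z2 z2']]]]]] := chord us sA sz.
pose t := s3 ++ s1.
have def_r : rot (size s1) s = a :: s2 ++ b :: t.
  by rewrite def_s rot_size_cat /t /= -!catA.
have ur : uniq (a :: s2 ++ b :: t) by rewrite -def_r rot_uniq.
have cr : cycle e (a :: s2 ++ b :: t) by rewrite -def_r rot_cycle.
have szr : size s = (size s2 + size t).+2.
  by rewrite -(size_rot (size s1)) def_r /= size_cat /= addnS.
have ss : subseq (a :: b :: t) (a :: s2 ++ b :: t).
  by rewrite /= eqxx suffix_subseq.
exists (a :: b :: t); split.
- move: cr; rewrite /= rcons_cat cat_path /= eab => /and3P[_ _ pb].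
  by [].
- exact: subseq_uniq ss ur.
- by move=> z /(mem_subseq ss); rewrite -def_r mem_rot; exact: sA.
- by rewrite szr /=; lia.
- by rewrite szr /=; lia.
Qed.

(** Since one shortening removes fewer than [2 * k] vertices, the first length below [n] still
    exceeds [n - 2 * k]. *)
Lemma mid_cycle x0 : x0 \in A -> 2 * k < n ->
  exists s, [/\ cycle e s, uniq s, {subset s <= A}, size s < n & n < size s + 2 * k].
Proof.
move=> Ax0 kn; have [s [cs us sA les]] := long_cycle Ax0.
move: {2}(size s) (leqnn (size s)) => N.
elim: N s cs us sA les => [|N IH] s cs us sA les leN; first by lia.
have [|s' [cs' us' sA' lt1 lt2]] := cycle_shorten cs us sA; first by lia.
have [le|lt] := leqP n (size s').
  by apply: (IH s') => //; lia.
by exists s'; split=> //; lia.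
Qed.

(** The path is cut at any inner vertex lying in [K1] or [K2], and bypassed along a chord while more
    than [2 * k] inner vertices remain. Each such step shortens it, so the process ends. *)
Lemma short_link (K1 K2 D : {set T}) a p : D \subset A ->
  (forall z, z \in K1 -> z \notin K2) -> a \in K1 -> path e a p ->
  last a p \in K2 -> {subset a :: p <= D} ->
  exists a' q b, [/\ a' \in K1, b \in K2, path e a' (rcons q b),
    uniq q & {subset q <= D :\: (K1 :|: K2)} /\ size q <= 2 * k].
Proof.
move=> sDA K12 K1a pp lp sp.
have [p' [pp' up' lp' sp']] : exists p', [/\ path e a p', uniq (a :: p'),
    last a p' \in K2 & {subset a :: p' <= D}].
  move: lp; case/shortenP: pp => p' pp' up' sub lp; exists p'; split=> //.
  by move=> z /[!inE] /orP[/eqP->|/sub zp]; apply: sp; rewrite inE ?eqxx ?zp ?orbT.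
move: {2}(size p') (leqnn (size p')) => N {p pp lp sp}.
elim: N a p' K1a pp' up' lp' sp' => [|N IH] a p K1a pp up lp sp leN.
  have p0 : p = [::] by apply/nilP; rewrite /nilp; lia.
  by rewrite p0 /= in lp; case/negP: (K12 a K1a).
have [/hasP[c cp /= K1c]|/hasPn nK1] := boolP (has (mem K1) p).
  case/splitPr: cp pp up lp sp leN => p1 p2 pp up lp sp leN.
  move: pp up lp; rewrite cat_path last_cat /= => /and3P[_ _ pc] /andP[_ up] lp.
  apply: (IH c p2) => //.
  - by move: up; rewrite cat_uniq => /and3P[].
  - by move=> z zin; apply: sp; rewrite inE mem_cat zin !orbT.
  - by move: leN; rewrite size_cat /=; lia.
case/lastP: p pp up lp sp leN nK1 => [|q b] pp up lp sp leN nK1.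
  by move: lp => /= K2a; case/negP: (K12 a K1a).
rewrite last_rcons in lp.
have [/hasP[c cq /= K2c]|/hasPn nK2] := boolP (has (mem K2) q).
  case/splitPr: cq pp up lp sp leN nK1 => p1 p2 pp up lp sp leN nK1.
  apply: (IH a (rcons p1 c)) => //.
  - by rewrite rcons_path; move: pp; rewrite rcons_cat cat_path /= => /and3P[-> ->].
  - move: up; rewrite rcons_cat -cat_rcons /= mem_cat cat_uniq negb_or.
    by case/andP=> /andP[-> _] /and3P[->].
  - by rewrite last_rcons.
  - move=> z; rewrite inE mem_rcons inE => zin; apply: sp.
    by rewrite inE mem_rcons inE mem_cat inE; case/or3P: zin => ->; rewrite ?orbT.
  - by move: leN; rewrite !size_rcons size_cat /=; lia.
have uq : uniq q by move: up; rewrite /= rcons_uniq => /and3P[].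
have sqD : {subset q <= D}.
  by move=> z zq; apply: sp; rewrite inE mem_rcons inE zq !orbT.
have [leq|ltq] := leqP (size q) (2 * k).
  exists a, q, b; split=> //; split=> // z zq; rewrite !inE sqD // andbT negb_or.
  by rewrite nK2 // nK1 // mem_rcons inE zq orbT.
have sqA : {subset q <= A} by move=> z /sqD; exact: (subsetP sDA).
have [s1 [c [s2 [d [s3 [def_q ecd z2 _]]]]]] := chord uq sqA ltq.
have ss : subseq (rcons (s1 ++ c :: d :: s3) b) (rcons q b).
  by rewrite def_q -!cats1 cat_subseq // cat_subseq //= eqxx suffix_subseq.
apply: (IH a (rcons (s1 ++ c :: d :: s3) b)) => //.
- move: pp; rewrite def_q !rcons_path !cat_path /= !cat_path /= !last_cat /= ecd.
  rewrite !last_cat /=.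
  by case/andP=> /and5P[-> -> _ _ ->] ->.
- by apply: subseq_uniq up; rewrite /= eqxx.
- by rewrite last_rcons.
- move=> z; rewrite inE => /orP[/eqP->|/(mem_subseq ss) zin]; apply: sp.
    exact: mem_head.
  by rewrite inE zin orbT.
- by move: leN; rewrite def_q !size_rcons !size_cat /= !size_cat /=; move: z2; clear; lia.
Qed.

Lemma walk_link (c a b d : T) w1 q w2 : walk e c a w1 ->
  path e a (rcons q b) -> walk e b d w2 -> walk e c d (w1 ++ q ++ w2).
Proof.
case: w1 => // c' t /and3P[/eqP-> pt /eqP la]; rewrite rcons_path => /andP[pq lq].
case: w2 => // b' w /and3P[/eqP-> pw /eqP ld].
by rewrite /walk /= eqxx !cat_path pt la pq /= lq pw !last_cat /= ld eqxx.
Qed.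

Lemma alpha_disconnected (A1 A2 : {set T}) :
  (forall x y, x \in A1 -> y \in A2 -> ~~ e x y) ->
  (forall x, x \in A1 -> x \notin A2) ->
  A1 \subset A -> A2 \subset A -> alpha A1 + alpha A2 <= k.
Proof.
move=> H D s1 s2; have [I1 [sI1 iI1 <-]] := alpha_witness e A1.
have [I2 [sI2 iI2 <-]] := alpha_witness e A2.
rewrite -cardU_disj; last first.
  move=> x /(subsetP sI1) /D; apply: contra; exact: subsetP.
apply: indep_leq.
  by rewrite subUset (subset_trans sI1 s1) (subset_trans sI2 s2).
by apply: indepU => // x y /(subsetP sI1) ? /(subsetP sI2) ?; exact: H.
Qed.

(** * Connectivity, with the statement for fewer cliques as induction hypothesis *)

Hypothesis cardA : #|A| = k * (n - 1).
Hypothesis k_ge2 : 2 <= k.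
Hypothesis systems : forall a (B : {set T}), a < k -> alpha B <= a ->
  #|B| = a * (n - 1) -> exists Q, clique_system e n B a Q.

(** Up to [k = 6] this rests on [n >= 24], beyond it on [n_ge]. *)
Lemma k_bound : 4 * k <= n.
Proof. by case: (leqP k 6) => h; [lia | nia]. Qed.

(** A larger set has room for a clique system and one more vertex, which [clique_system_extra] turns
    into [a + 1] independent vertices. *)
Lemma size_bound a (B : {set T}) : a < k -> alpha B <= a -> #|B| <= a * (n - 1).
Proof.
move=> ak aB; rewrite leqNgt; apply/negP => lt; have kb := k_bound.
have [B' sB' cB'] := subset_card (ltnW lt).
have [|Q HQ] := systems ak _ cB'; first exact: leq_trans (alphaS e sB') aB.
have [v Bv nBv] : exists2 v, v \in B & v \notin B'.
  by apply/subsetPn; apply/negP => /subset_leq_card; lia.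
have := clique_system_extra e_sym e_irr noC _ _ sB' HQ Bv nBv.
by move=> /(_ ltac:(lia) ltac:(lia)); lia.
Qed.

(** The two sides have independence numbers adding up to at most [k] and sizes adding up to
    [k * (n - 1) - 1], so one side attains the bound of [size_bound]. By [systems] it contains a
    [K_(n-1)], which [no_big_clique] forbids. *)
Lemma cut_vertex x (A1 A2 : {set T}) : x \in A -> A1 :|: A2 = A :\ x ->
  (forall x y, x \in A1 -> y \in A2 -> ~~ e x y) ->
  (forall x, x \in A1 -> x \notin A2) -> A1 != set0 -> A2 != set0 -> False.
Proof.
move=> Ax EA H D n1 n2; have kb := k_bound.
have sub : A1 :|: A2 \subset A by rewrite EA subD1set.
have [s1 s2] : A1 \subset A /\ A2 \subset A by apply/andP; rewrite -subUset.
have a12 := alpha_disconnected H D s1 s2.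
have pos (B : {set T}) : B != set0 -> 0 < alpha B.
  case/set0Pn=> y By; rewrite -(cards1 y); apply: alpha_max; rewrite ?sub1set //.
  exact: indep1.
have p1 := pos _ n1; have p2 := pos _ n2.
have c12 : #|A1| + #|A2| = k * (n - 1) - 1.
  by rewrite -cardU_disj // EA -cardA (cardsD1 x A) Ax; lia.
have b1 := @size_bound (alpha A1) A1 ltac:(lia) (leqnn _).
have b2 := @size_bound (alpha A2) A2 ltac:(lia) (leqnn _).
have bad (B : {set T}) : B \subset A -> 0 < alpha B < k ->
    #|B| = alpha B * (n - 1) -> False.
  move=> sB /andP[aB0 aBk] cB; have [Q [HQ _]] := systems aBk (leqnn _) cB.
  have [sQ cQ nQ] := HQ 0 aB0.
  by apply: no_big_clique (subset_trans sQ sB) cQ nQ _; lia.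
have [E1|nE1] := eqVneq #|A1| (alpha A1 * (n - 1)).
  by apply: (bad A1) => //; lia.
apply: (bad A2) => //; first by lia.
have : alpha A1 + alpha A2 = k by nia.
nia.
Qed.

(** * Independent triples in large neighbourhoods *)

Lemma traceable_or_two_cliques (M : {set T}) : M != set0 ->
  (forall a b c, a \in M -> b \in M -> c \in M -> a != b -> a != c -> b != c ->
     [|| e a b, e a c | e b c]) ->
  (exists a b s, [/\ walk e a b s, uniq s & s =i M]) \/
  (exists K1 K2 : {set T}, [/\ K1 :|: K2 = M, forall z, z \in K1 -> z \notin K2,
     K1 != set0, K2 != set0 & clique K1 && clique K2]).
Proof.
move=> /set0Pn[a0 Ma0] no3.
suff H N a p : path e a p -> uniq (a :: p) -> {subset a :: p <= M} ->
    #|M| - size p <= N ->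
  (exists a b s, [/\ walk e a b s, uniq s & s =i M]) \/
  (exists K1 K2 : {set T}, [/\ K1 :|: K2 = M, forall z, z \in K1 -> z \notin K2,
     K1 != set0, K2 != set0 & clique K1 && clique K2]).
  by apply: (H #|M| a0 [::]) => //=; [move=> z /[!inE] /eqP-> | lia].
elim: N a p => [|N IH] a p pp up sp leN.
  have : size (a :: p) <= #|M|.
    by rewrite -(card_uniqP up); apply: subset_leq_card; exact/subsetP.
  by rewrite /=; lia.
have szM : size p < #|M|.
  by rewrite -[(size p).+1]/(size (a :: p)) -(card_uniqP up); apply: subset_leq_card; exact/subsetP.
have [Ms|/subsetPn[v0 Mv0 nv0]] := boolP (M \subset a :: p).
  left; exists a, (last a p), (a :: p); split=> //; first exact: walk_path.
  by move=> z; apply/idP/idP => [/sp//|/(subsetP Ms)].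
have [/exists_inP[v Mv /andP[nv eva]]|/exists_inPn E1] :=
  boolP [exists v in M, (v \notin a :: p) && e v a].
  apply: (IH v (a :: p)) => /=; rewrite ?eva ?nv //; last by move: szM leN; clear; lia.
  by move=> z /[!inE] /orP[/eqP->//|]; apply: sp.
have [/exists_inP[v Mv /andP[nv evl]]|/exists_inPn E2] :=
  boolP [exists v in M, (v \notin a :: p) && e v (last a p)].
  apply: (IH a (rcons p v)); rewrite ?size_rcons; last by move: szM leN; clear; lia.
  - by rewrite rcons_path pp e_sym.
  - by rewrite -rcons_cons rcons_uniq nv.
  - by move=> z; rewrite -rcons_cons mem_rcons inE => /orP[/eqP->//|]; apply: sp.
(* As [v0] sees neither end of the path, the ends are adjacent and the path closes to a cycle. If an
   edge [u v] leaves it, opening the cycle at [u] and adding [v] gives a longer path. *)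
have [/exists_inP[u Mu /exists_inP[v Mv /and3P[su nv euv]]]|noE] :=
  boolP [exists u in M, exists v in M, [&& u \in a :: p, v \notin a :: p & e u v]].
  have na : ~~ e v0 a by have := E1 v0 Mv0; rewrite nv0.
  have nl : ~~ e v0 (last a p) by have := E2 v0 Mv0; rewrite nv0.
  have Mal : last a p \in M by apply: sp; exact: mem_last.
  have Maa : a \in M by apply: sp; exact: mem_head.
  have nal : a != last a p.
    case: (p) up su nl E1 nv => [|c q] /= up su nl E1 nv; last first.
      by apply/eqP => E; move: up; rewrite {1}E mem_last.
    rewrite inE in su; have := E1 v Mv; rewrite nv /= e_sym.
    by rewrite -(eqP su) euv.
  have eal : e (last a p) a.
    have := no3 v0 a (last a p) Mv0 Maa Mal.
    rewrite (negPf na) (negPf nl) /= e_sym; apply=> //.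
      by apply: contraNneq nv0 => ->; exact: mem_head.
    by apply: contraNneq nv0 => ->; exact: mem_last.
  have cs : cycle e (a :: p) by rewrite /= rcons_path pp eal.
  have [i r def_r] := rot_to su.
  have cr : cycle e (u :: r) by rewrite -def_r rot_cycle.
  have szr : size r = size p.
    by have := size_rot i (a :: p); rewrite def_r => -[].
  apply: (IH v (u :: r)).
  - by rewrite /= [e v u]e_sym euv; move: cr; rewrite /= rcons_path => /andP[].
  - by rewrite cons_uniq -def_r mem_rot nv rot_uniq.
  - move=> z; rewrite inE -def_r mem_rot => /orP[/eqP->//|]; exact: sp.
  - by rewrite /= szr; move: szM leN; clear; lia.
have nE u v : u \in a :: p -> v \in M -> v \notin a :: p -> ~~ e u v.
  move=> su Mv nv; apply: contra noE => euv.
  apply/exists_inP; exists u; first exact: sp.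
  by apply/exists_inP; exists v; rewrite // su nv.
(* No edge leaves the path, so a non-adjacent pair on one side and a vertex of the other would be an
   independent triple. *)
right; exists [set z in a :: p], (M :\: [set z in a :: p]); split.
- apply/setP => z; rewrite in_setU in_setD !inE.
  by case: (boolP ((z == a) || (z \in p))) => //= zin; rewrite sp // inE.
- by move=> z zs; rewrite in_setD zs.
- by apply/set0Pn; exists a; rewrite !inE eqxx.
- by apply/set0Pn; exists v0; rewrite in_setD Mv0 andbT inE.
apply/andP; split; apply/cliqueP => y z.
  rewrite !inE -!in_cons => sy sz nyz.
  have := no3 y z v0 (sp _ sy) (sp _ sz) Mv0 nyz.
  rewrite (negPf (nE y v0 sy Mv0 nv0)) (negPf (nE z v0 sz Mv0 nv0)) !orbF.
  by apply; apply: contraNneq nv0 => <-.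
rewrite !in_setD !inE -!in_cons => /andP[ny My] /andP[nz Mz] nyz.
have sa := mem_head a p.
have := no3 y z a My Mz (sp _ sa) nyz.
rewrite [e y a]e_sym [e z a]e_sym (negPf (nE a y sa My ny)) (negPf (nE a z sa Mz nz)) !orbF.
by apply; [apply: contraNneq ny => -> | apply: contraNneq nz => ->].
Qed.

(** The cycle runs from [x] through [m1] vertices of [K1], the link [q] and [m2] vertices of [K2].
    The free choice of [m1] and [m2] lets its length be tuned to [n]; the last clause is for using
    both cliques entirely, as a start for [dense_cycle]. *)
Lemma theta_cycle x (K1 K2 : {set T}) a q b m1 m2 : x \in A ->
  K1 \subset A -> K2 \subset A -> (forall z, z \in K1 -> z \notin K2) ->
  clique K1 -> clique K2 -> (forall y, y \in K1 :|: K2 -> e x y) ->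
  a \in K1 -> b \in K2 -> path e a (rcons q b) -> uniq q ->
  {subset q <= (A :\ x) :\: (K1 :|: K2)} ->
  0 < m1 <= #|K1| -> 0 < m2 <= #|K2| ->
  exists s, [/\ cycle e s, uniq s, {subset s <= A}, size s = (m1 + size q + m2).+1 &
    m1 = #|K1| -> m2 = #|K2| -> {subset x |: (K1 :|: K2) <= s}].
Proof.
move=> Ax s1 s2 D cK1 cK2 ex K1a K2b pq uq sq hm1 hm2.
have [c1 [w1 [ww1 uw1 sw1 zw1 _]]] := clique_walk cK1 K1a hm1.
have [c2 [w2 [ww2 uw2 sw2 zw2 _]]] := clique_walk cK2 K2b hm2.
have wl c d w : walk e c d w -> d \in w.
  by case: w => // c' w /and3P[_ _ /eqP<-]; exact: mem_last.
have W := walk_link (walk_rev e_sym ww1) pq ww2.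
have xc1 : e x c1 by apply: ex; rewrite inE sw1 // (wl _ _ _ ww1).
have xc2 : e c2 x by rewrite e_sym ex // inE sw2 ?orbT // (wl _ _ _ ww2).
have nxK : x \notin K1 :|: K2 by apply/negP => /ex; rewrite e_irr.
exists (x :: rev w1 ++ q ++ w2); split.
- exact: walk_cycle (walk_cons xc1 W) xc2.
- rewrite cons_uniq !mem_cat mem_rev !negb_or !cat_uniq rev_uniq uw1 uq uw2 /= andbT.
  move: nxK; rewrite inE negb_or => /andP[nx1 nx2].
  rewrite (contra (sw1 x)) // (contra (sw2 x)) // andbT /=.
  apply/and3P; split.
  + by apply/negP => /sq; rewrite !inE eqxx andbF.
  + apply/hasPn => z; rewrite mem_cat /= mem_rev => zin; apply/negP => /sw1 K1z.
    case/orP: zin => [/sq|/sw2]; first by rewrite !inE K1z.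
    by apply/negP; exact: D.
  + by apply/hasPn => z /sw2 K2z; apply/negP => /sq; rewrite !inE K2z orbT.
- move=> z; rewrite inE !mem_cat mem_rev => /or4P[/eqP->//|/sw1|/sq|/sw2].
  + exact: (subsetP s1).
  + by rewrite !inE => /and3P[].
  + exact: (subsetP s2).
- by rewrite /= !size_cat size_rev zw1 zw2 addnA.
move=> E1 E2; have full (K : {set T}) w m : uniq w -> {subset w <= K} -> size w = m ->
    m = #|K| -> forall z, z \in K -> z \in w.
  move=> uw sw <- E z Kz.
  have -> : w =i K by apply: subset_cardP; [rewrite (card_uniqP uw) | exact/subsetP].
  exact: Kz.
move=> z; rewrite in_setU1 in_setU inE !mem_cat mem_rev => /or3P[->//|Kz|Kz].
  by rewrite (full _ _ _ uw1 sw1 zw1 E1 z Kz) !orbT.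
by rewrite (full _ _ _ uw2 sw2 zw2 E2 z Kz) !orbT.
Qed.

(** Without a triple, [x |: M] has independence number at most 2, and by [dense_cycle] no cycle
    shorter than [n] contains it. Yet either [M] has a Hamiltonian path, which closes through [x],
    or it splits into two cliques, which are linked outside [x] unless [x] is a cut vertex. *)
Lemma neighbourhood_alpha3 x (M : {set T}) : x \in A -> M \subset A ->
  (forall y, y \in M -> e x y) -> n - k <= #|M| ->
  exists I : {set T}, [/\ I \subset M, indep I & #|I| = 3].
Proof.
move=> Ax; have kb := k_bound.
(* The exact size keeps the cycle built from [x] and a Hamiltonian path of [M] shorter than [n]. *)
wlog cM : M / #|M| = n - k.
  move=> W sM exM leM; have [M' sM' cM'] := subset_card leM.
  have [|y /(subsetP sM')/exM//||I [sI iI cI]] := W M' cM'.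
  - exact: subset_trans sM' sM.
  - by rewrite cM'.
  by exists I; split=> //; exact: subset_trans sI sM'.
move=> sM exM _.
have [/existsP[I /and3P[sI iI /eqP cI]]|noI] :=
  boolP [exists I : {set T}, [&& I \subset M, indep I & #|I| == 3]].
  by exists I.
exfalso.
have no3 a b c : a \in M -> b \in M -> c \in M -> a != b -> a != c -> b != c ->
     [|| e a b, e a c | e b c].
  move=> Ma Mb Mc nab nac nbc; apply: contraNT noI; rewrite !negb_or => /and3P[n1 n2 n3].
  apply/existsP; exists [set a; b; c]; rewrite indep3 //.
  rewrite !subUset !sub1set Ma Mb Mc /= setUC cardsU1 cards2 !inE nab negb_or.
  by rewrite ![c == _]eq_sym nac nbc.
have aB (I : {set T}) : I \subset x |: M -> indep I -> #|I| <= 2.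
  move=> sI iI; rewrite leqNgt; apply/negP => lt.
  have [Ix|nIx] := boolP (x \in I).
    suff : #|I| <= #|[set x]| by rewrite cards1; lia.
    apply: subset_leq_card; apply/subsetP => y Iy; rewrite inE.
    have := subsetP sI y Iy; rewrite inE => /orP[/set1P->//|/exM exy].
    by have := indepP _ _ iI x y Ix Iy; rewrite exy.
  have [I' sI' cI'] := subset_card lt.
  case/negP: noI; apply/existsP; exists I'; rewrite cI' eqxx andbT.
  rewrite (indep_sub sI' iI) andbT; apply/subsetP => y /(subsetP sI') Iy.
  have := subsetP sI y Iy; rewrite inE => /orP[/set1P E|//].
  by rewrite -E Iy in nIx.
have nxM : x \notin M by apply/negP => /exM; rewrite e_irr.
have cB : #|x |: M| = (n - k).+1 by rewrite cardsU1 nxM cM.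
have leB : n + k * 2 <= 2 * #|x |: M| by rewrite cB; lia.
have Mn0 : M != set0 by rewrite -card_gt0 cM; lia.
have [[a [b [s [ws us sE]]]]|[K1 [K2 [KE D K1n K2n /andP[cK1 cK2]]]]] :=
  traceable_or_two_cliques Mn0 no3.
  have [Ma Mb] : a \in M /\ b \in M.
    rewrite -!sE; case: s ws {us sE} => // c s /and3P[/eqP-> _ /eqP<-].
    by rewrite mem_head mem_last.
  apply: (dense_cycle (s := x :: s) aB leB).
  - by apply: walk_cycle (walk_cons (exM a Ma) ws) _; rewrite e_sym exM.
  - by rewrite cons_uniq us andbT sE.
  - by move=> z; rewrite inE sE => /orP[/eqP->//|]; exact: (subsetP sM).
  - by move=> z; rewrite !inE sE.
  - have : size s = #|M| by rewrite -(card_uniqP us); apply: eq_card.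
    by rewrite cM /=; lia.
have [s1 s2] : K1 \subset A /\ K2 \subset A.
  by apply/andP; rewrite -subUset KE.
have ex y : y \in K1 :|: K2 -> e x y by rewrite KE; exact: exM.
have cK : #|K1| + #|K2| = n - k by rewrite -cardU_disj // KE.
have K1p : 0 < #|K1| by rewrite card_gt0.
have K2p : 0 < #|K2| by rewrite card_gt0.
pose D0 := A :\ x.
pose r := [rel y z | [&& e y z, y \in D0 & z \in D0]].
have [a K1a] := set0Pn _ K1n; have [b K2b] := set0Pn _ K2n.
have inD y : y \in K1 :|: K2 -> y \in D0.
  rewrite KE => My; rewrite !inE (subsetP sM _ My) andbT.
  by apply: contraNneq nxM => <-.
have [/exists_inP[b' K2b' /connectP[p pp lp]]|/exists_inPn nK2] :=
    boolP [exists y in K2, connect r a y].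
  have pe : path e a p by apply: sub_path pp => y z /and3P[].
  have sp : {subset a :: p <= D0}.
    have Da : a \in D0 by apply: inD; rewrite inE K1a.
    elim: p a Da pp {K1a lp pe} => [|c p IHp] a' Da.
      by move=> _ z; rewrite mem_seq1 => /eqP->.
    case/andP=> /and3P[_ _ Dc] pc z; rewrite inE => /orP[/eqP->//|].
    exact: IHp Dc pc z.
  rewrite lp in K2b'.
  have [a1 [q [b1 [K1a1 K2b1 pq uq [sq szq]]]]] :=
    short_link (subD1set _ _) D K1a pe K2b' sp.
  have TC m1 m2 := @theta_cycle x K1 K2 a1 q b1 m1 m2 Ax s1 s2 D cK1 cK2 ex K1a1 K2b1 pq uq sq.
  (* The cliques have [n - k] vertices in all. With at least [k - 1] link vertices they can be
     trimmed to a cycle of length exactly [n]; with fewer, the cycle through all of them is shorter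
     than [n]. *)
  have [leq|ltq] := leqP (k - 1) (size q).
    have [m1 [m2 [h1 h2 h]]] : exists m1 m2, [/\ 0 < m1 <= #|K1|, 0 < m2 <= #|K2| &
        (m1 + size q + m2).+1 = n].
      (* As much of [K1] as possible, leaving at least one vertex for [K2]. *)
      exists (minn #|K1| (n - 2 - size q)).
      exists (n - 1 - size q - minn #|K1| (n - 2 - size q)).
      by move: K1p K2p cK szq kb k_ge2 leq n_ge24; clear; split; lia.
    have [s [cs us _ szs _]] := TC m1 m2 h1 h2.
    by apply: noC cs us _; rewrite szs.
  have h1 : 0 < #|K1| <= #|K1| by rewrite K1p /=.
  have h2 : 0 < #|K2| <= #|K2| by rewrite K2p /=.
  have [s [cs us sA szs /(_ erefl erefl) sB]] := TC #|K1| #|K2| h1 h2.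
  apply: (dense_cycle aB leB cs us sA); first by rewrite -KE.
  by rewrite szs; move: cK kb k_ge2 ltq; clear; lia.
(* Here [x] separates [a] from [K2]: the component of [a] in [A :\ x] is set against the rest. *)
pose A1 := [set y in D0 | connect r a y].
have Da : a \in D0 by apply: inD; rewrite inE K1a.
apply: (@cut_vertex x A1 (D0 :\: A1) Ax).
- by apply/setP => z; rewrite in_setU in_setD inE; case: (z \in D0); case: (connect r a z).
- move=> y z; rewrite [y \in _]inE in_setD => /andP[Dy cy] /andP[nz Dz].
  apply: contra nz => eyz; rewrite inE Dz; apply: connect_trans cy _.
  by apply: connect1; rewrite /r /= eyz Dy.
- by move=> y yA; rewrite in_setD yA.
- by apply/set0Pn; exists a; rewrite inE Da connect0.
- apply/set0Pn; exists b; have Db : b \in D0 by apply: inD; rewrite inE K2b orbT.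
  by rewrite in_setD Db andbT inE Db nK2.
Qed.

(** Of at least [n - 1] neighbours fewer than [k] lie on [s], so at least [n - k] lie outside. *)
Lemma outside_alpha3 (s : seq T) x : x \in A ->
  #|[set u in s | e x u]| < k ->
  exists I : {set T}, [/\ I \subset [set y in A | e x y & y \notin s], indep I & #|I| = 3].
Proof.
move=> Ax dx; apply: (@neighbourhood_alpha3 x) => //.
- by apply/subsetP => y; rewrite inE => /andP[].
- by move=> y; rewrite inE => /and3P[].
have le : #|nbrs x A| <= #|[set u in s | e x u] :|: [set y in A | e x y & y \notin s]|.
  apply: subset_leq_card; apply/subsetP => y; rewrite !inE => /andP[-> ->] /=.
  by rewrite andbT orbN.
have := min_degree Ax; have := leq_card_setU [set u in s | e x u] [set y in A | e x y & y \notin s].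
move=> [le' _]; move: le le' dx; clear; lia.
Qed.

(** * Longest cycles of length at most [n - 2] *)

Section Stuck.
Variable s : seq T.
Hypotheses (cs : cycle e s) (us : uniq s) (sA : {subset s <= A}).
Hypothesis max_s : forall s', cycle e s' -> uniq s' -> {subset s' <= A} ->
  size s < size s' <= n -> False.

(** A path outside [s] short enough that absorbing it would give a longer cycle of length at most
    [n], against [max_s]. *)
Let good w W := [/\ path e w W, uniq (w :: W), {subset w :: W <= A},
  forall z, z \in w :: W -> z \notin s & size s + (size W).+1 <= n].

Lemma stuck_ext s' w W : good w W -> cycle e s' -> uniq s' ->
  perm_eq s' (s ++ w :: W) -> False.
Proof.
move=> [_ _ sW _ szW] cs' us' ps'; apply: (max_s cs' us').
  by move=> z; rewrite (perm_mem ps') mem_cat => /orP[/sA|/sW].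
by rewrite (perm_size ps') size_cat /=; move: szW; clear; lia.
Qed.

Lemma stuck_insert w W u : good w W -> u \in s -> e u w ->
  ~~ e (last w W) (next s u).
Proof.
move=> gW su euw; apply/negP => el; have [pW uW _ dW _] := gW.
have dW' : ~~ has (mem s) (w :: W) by apply/hasPn.
have [s' cs' [us' ps']] := cycle_insert cs us su pW uW dW' euw el.
exact: stuck_ext gW cs' us' ps'.
Qed.

Lemma stuck_cross w W u u' : good w W -> u \in s -> u' \in s -> e u w ->
  e (last w W) u' -> ~~ e (next s u) (next s u').
Proof.
move=> gW su su' euw el; apply/negP => en; have [pW uW _ dW _] := gW.
have [uu|nuu] := eqVneq u u'; first by rewrite uu e_irr in en.
have dW' : ~~ has (mem s) (w :: W) by apply/hasPn.
have [s' cs' [us' ps']] := cycle_cross e_sym cs us su su' nuu pW uW dW' euw el en.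
exact: stuck_ext gW cs' us' ps'.
Qed.

Lemma good1 x : x \in A -> x \notin s -> size s < n -> good x [::].
Proof.
move=> Ax nx lt; split=> //=; last by rewrite addn1.
  by move=> z; rewrite mem_seq1 => /eqP->.
by move=> z; rewrite mem_seq1 => /eqP->.
Qed.

Lemma good2 x y : x \in A -> x \notin s -> y \in A -> y \notin s -> e x y ->
  size s + 2 <= n -> good x [:: y].
Proof.
move=> Ax nx Ay ny exy lt; split=> //=.
- by rewrite exy.
- by rewrite inE andbT; apply/eqP => E; rewrite E e_irr in exy.
- by move=> z; rewrite !inE => /orP[]/eqP->.
- by move=> z; rewrite !inE => /orP[]/eqP->.
Qed.

Lemma good3 x y z : x \in A -> x \notin s -> y \in A -> y \notin s ->
  z \in A -> z \notin s -> e x y -> e y z -> x != z ->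
  size s + 3 <= n -> good x [:: y; z].
Proof.
move=> Ax nx Ay ny Az nz exy eyz nxz lt; split=> //=.
- by rewrite exy eyz.
- rewrite !inE negb_or nxz !andbT; apply/andP; split.
    by apply/eqP => E; rewrite E e_irr in exy.
  by apply/eqP => E; rewrite E e_irr in eyz.
- by move=> t; rewrite !inE => /or3P[]/eqP->.
- by move=> t; rewrite !inE => /or3P[]/eqP->.
Qed.

Lemma indep_next (I Z : {set T}) : I \subset A -> indep I ->
  (forall z, z \in I -> z \notin s) -> {subset Z <= s} ->
  (forall u u', u \in Z -> u' \in Z -> ~~ e (next s u) (next s u')) ->
  (forall z u, z \in I -> u \in Z -> ~~ e z (next s u)) -> #|I| + #|Z| <= k.
Proof.
move=> sI iI dI sZ H1 H2; rewrite -(card_next Z us) -cardU_disj; last first.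
  move=> z /dI; apply: contra => /imsetP[u /sZ su ->].
  by rewrite mem_next.
apply: indep_leq.
  by rewrite subUset sI; apply/subsetP => _ /imsetP[u /sZ su ->]; rewrite sA // mem_next.
apply: indepU => //.
  by apply/indepP => _ _ /imsetP[u Zu ->] /imsetP[u' Zu' ->]; exact: H1.
by move=> z _ Iz /imsetP[u Zu ->]; exact: H2.
Qed.

(** Covering [s] by the neighbourhoods of one dominating set gives only [size s <= k * (k - 3)], too
    weak against [size s > n - 2 * k]. The gain comes from a second dominating set, three members of
    which jointly see at most [k - 3] vertices of [s]. *)
Lemma stuck_contradiction : size s + 2 <= n -> n < size s + 2 * k -> False.
Proof.
move=> sz2 szk.
have lt1 : size s < n by move: sz2; clear; lia.
pose D x := [set u in s | e x u].
pose M x := [set y in A | e x y & y \notin s].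
have DP x u : u \in D x -> u \in s /\ e x u by rewrite inE => /andP.
have DP' x u : u \in D x -> e u x by move/DP => [_]; rewrite e_sym.
have MP x y : y \in M x -> [/\ y \in A, e x y & y \notin s] by rewrite inE => /and3P.
have sD x : {subset D x <= s} by move=> u /DP[].
have Dnext x u u' : x \in A -> x \notin s -> u \in D x -> u' \in D x ->
    ~~ e (next s u) (next s u').
  move=> Ax nx Du Du'; have [[su _] [su' xu']] := (DP _ _ Du, DP _ _ Du').
  exact: stuck_cross (good1 Ax nx lt1) su su' (DP' _ _ Du) xu'.
have Dself x u : x \in A -> x \notin s -> u \in D x -> ~~ e x (next s u).
  move=> Ax nx Du; have [su _] := DP _ _ Du.
  exact: stuck_insert (good1 Ax nx lt1) su (DP' _ _ Du).
have dlt x : x \in A -> x \notin s -> #|D x| < k.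
  move=> Ax nx.
  have := @indep_next [set x] (D x); rewrite cards1; apply=> //.
  - by rewrite sub1set.
  - exact: indep1.
  - by move=> z /set1P->.
  - by move=> u u' Du Du'; exact: Dnext Du Du'.
  - by move=> z u /set1P->; exact: Dself.
have I3 x : x \in A -> x \notin s ->
    exists I : {set T}, [/\ I \subset M x, indep I & #|I| = 3].
  by move=> Ax nx; exact: outside_alpha3 (dlt x Ax nx).
have IA x (I : {set T}) : I \subset M x -> I \subset A.
  by move=> sI; apply/subsetP => z /(subsetP sI)/MP[].
have Is x (I : {set T}) : I \subset M x -> forall z, z \in I -> z \notin s.
  by move=> sI z /(subsetP sI)/MP[].
(* An outside neighbour [z] of [x] sees no successor of [D x], since the path [x, z] could be
   inserted; so a whole triple joins these successors. *)
have d3 x : x \in A -> x \notin s -> 3 + #|D x| <= k.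
  move=> Ax nx; have [I [sI iI cI]] := I3 x Ax nx; rewrite -cI.
  apply: (@indep_next I (D x)) => //; [exact: IA sI|exact: Is sI|..].
    by move=> u u' Du Du'; exact: Dnext Du Du'.
  move=> z u /(subsetP sI)/MP[Az exz nz] Du; have [su _] := DP _ _ Du.
  exact: (stuck_insert (good2 Ax nx Az nz exz sz2) su (DP' _ _ Du)).
have cS : #|[set z in s]| = size s by rewrite cardsE; exact/card_uniqP.
have [|J [sJ iJ cJ]] := dom_set (X := [set z in s]).
  by rewrite cS; move: lt1; clear; lia.
have JA x : x \in J -> x \in A by move/(subsetP sJ); rewrite inE => /andP[].
have nJ x : x \in J -> x \notin s by move/(subsetP sJ); rewrite !inE => /andP[].
have sJA : J \subset A by apply/subsetP.
have domJ (J' : {set T}) u : J' \subset A -> indep J' -> #|J'| = k ->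
    (forall z, z \in J' -> z \notin s) -> u \in s -> exists2 x, x \in J' & e x u.
  move=> sJ' iJ' cJ' nJ' su; apply: dominates => //; first exact: sA.
  by apply/negP => /nJ'; rewrite su.
have nD x (X : {set T}) c : {subset X <= s} -> #|D x| <= c -> #|[set u in X | e x u]| <= c.
  move=> sX; apply: leq_trans; apply: subset_leq_card; apply/subsetP => u.
  by rewrite !inE => /andP[/sX-> ->].
have sS : {subset [set z in s] <= s} by move=> z; rewrite inE.
have k3 : 3 <= k.
  have [x Jx] : exists x, x \in J by apply/card_gt0P; rewrite cJ; move: k_ge2; clear; lia.
  by have := d3 x (JA x Jx) (nJ x Jx); clear; lia.
have le1 : size s <= k * (k - 3).
  rewrite -cS -{1}cJ; apply: (card_cover (e := e)) => [u|x Jx].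
    by rewrite inE; exact: domJ.
  by apply: nD => //; have := d3 x (JA x Jx) (nJ x Jx); clear; lia.
have sz3 : size s + 3 <= n.
  by move: le1 n_ge n_ge24 k3; clear; case: (leqP k 6) => h; [lia | nia].
(* If every member of [J] saw at most [k - 4] vertices of [s], then
   [size s <= k * (k - 4) <= n - 2 * k]. So some [x] attains [k - 3]. *)
have [/exists_inP[x Jx dx]|/exists_inPn nx4] :=
    boolP [exists x in J, k < #|D x| + 4]; last first.
  have le2 : size s <= k * (k - 4).
    rewrite -cS -{1}cJ; apply: (card_cover (e := e)) => [u|x Jx].
      by rewrite inE; exact: domJ.
    by apply: nD => //; have := nx4 x Jx; clear; lia.
  by move: le2 szk n_ge n_ge24 k3; clear; case: (leqP k 6) => h; [lia | nia].
have Ax := JA x Jx; have nx := nJ x Jx.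
have [I [sI iI cI]] := I3 x Ax nx.
(* A member [z] of [J] reached from [x] through an outside vertex [w] gives an insertable path
   [x, w, z]; by [cJn] there are at most two such members. *)
pose Jn := [set z in J :\ x | [exists w in M x, e w z]].
pose Jf := (J :\ x) :\: Jn.
have JfP z : z \in Jf -> [/\ z \in J, z != x & forall w, w \in M x -> ~~ e w z].
  rewrite in_setD => /andP[nz Jz]; have := Jz; rewrite !inE => /andP[zx Jz'].
  split=> // w Mw; apply: contra nz => ewz; rewrite inE Jz /=.
  by apply/exists_inP; exists w.
have JnP z : z \in Jn -> [/\ z \in J, z != x & exists2 w, w \in M x & e w z].
  by rewrite !inE => /andP[/andP[zx Jz] /exists_inP].
have sJn : x |: Jn \subset J.
  by rewrite subUset sub1set Jx; apply/subsetP => z /JnP[].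
have cJn : #|x |: Jn| + #|D x| <= k.
  apply: indep_next => //.
  - exact: subset_trans sJn sJA.
  - exact: indep_sub sJn iJ.
  - by move=> z /(subsetP sJn)/nJ.
  - by move=> u u' Du Du'; exact: Dnext Du Du'.
  move=> z u /setU1P[->|/JnP[Jz zx [w /MP[Aw exw nw] ewz]]] Du; first exact: Dself.
  have [su _] := DP _ _ Du.
  have g := @good3 x w z Ax nx Aw nw (JA z Jz) (nJ z Jz) exw ewz.
  have xz : x != z by rewrite eq_sym.
  exact: (stuck_insert (g xz sz3) su (DP' _ _ Du)).
have nxJn : x \notin Jn by rewrite !inE eqxx.
have sJnJ : Jn \subset J :\ x by apply/subsetP => z; rewrite inE => /andP[].
have cJf : #|Jf| + #|Jn| + 1 = k.
  have := cardsD (J :\ x) Jn; rewrite (setIidPr sJnJ) -/Jf.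
  have := subset_leq_card sJnJ; have := cardsD1 x J; rewrite Jx cJ; clear; lia.
have leJf : k <= #|Jf| + 3.
  by move: cJf cJn dx; rewrite cardsU1 nxJn; clear; lia.
have dIJf z : z \in I -> z \notin Jf.
  move=> /(subsetP sI)/MP[_ exz _]; apply/negP => /JfP[Jz _ _].
  by have := indepP _ _ iJ x z Jx Jz; rewrite exz.
(* Trading [x] and [Jn] for the triple [I] produces the second dominating [k]-set. *)
have iJ' : indep (I :|: Jf).
  apply: indepU => //.
    by apply: indep_sub iJ; apply/subsetP => z /JfP[].
  by move=> w z /(subsetP sI) Mw /JfP[_ _]; apply.
have sJ' : I :|: Jf \subset A.
  by rewrite subUset (IA x) //; apply/subsetP => z /JfP[/JA].
have cJ' : #|I :|: Jf| = k.
  apply/eqP; rewrite eqn_leq indep_leq //= cardU_disj // cI addnC; exact: leJf.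
have nJ' z : z \in I :|: Jf -> z \notin s.
  by case/setUP => [/(Is x _ sI)|/JfP[/nJ]].
pose Z := [set u in s | [exists w in I, e w u]].
have ZP u : u \in Z -> u \in s /\ exists w, [/\ w \in M x, w \in I & e w u].
  rewrite inE => /andP[su /exists_inP[w Iw ewu]]; split=> //.
  by exists w; rewrite (subsetP sI).
(* Any two vertices of [M x] are joined by an outside path through [x], so towards [s] the triple
   behaves like a single vertex and [#|Z| <= k - 3]. *)
have route w w' : w \in M x -> w' \in M x ->
    exists W, good w W /\ last w W = w'.
  move=> /MP[Aw exw nw] /MP[Aw' exw' nw'].
  have [<-|nww] := eqVneq w w'; first by exists [::]; split=> //; exact: good1.
  by exists [:: x; w']; split=> //; apply: good3 => //; rewrite e_sym.
have cZ : 3 + #|Z| <= k.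
  rewrite -cI; apply: indep_next => //; [exact: IA sI|exact: Is sI| |..].
  - by move=> u /ZP[].
  - move=> u u' /ZP[su [w [Mw _ ewu]]] /ZP[su' [w' [Mw' _ ewu']]].
    have [W [gW lW]] := route w w' Mw Mw'.
    by apply: (stuck_cross gW su su'); rewrite ?lW // e_sym.
  - move=> w' u /(subsetP sI) Mw' /ZP[su [w [Mw _ ewu]]].
    have [W [gW <-]] := route w w' Mw Mw'.
    by apply: (stuck_insert gW su); rewrite e_sym.
have cS' : #|[set z in s] :\: Z| <= #|Jf| * (k - 3).
  apply: (card_cover (e := e)) => [u|z Jz].
    rewrite in_setD inE => /andP[nZu su].
    have [z /setUP[Iz|Jz] ezu] := domJ _ u sJ' iJ' cJ' nJ' su; last by exists z.
    by case/negP: nZu; rewrite inE su; apply/exists_inP; exists z.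
  have [Jz' _ _] := JfP z Jz.
  apply: nD; first by move=> u; rewrite in_setD inE => /andP[].
  by have := d3 z (JA z Jz') (nJ z Jz'); clear; lia.
have sZ : Z \subset [set z in s] by apply/subsetP => u /ZP[su _]; rewrite inE.
have eJf : #|Jf| = k - 3.
  by move: cJ'; rewrite cardU_disj // cI; clear; lia.
move: cS'; rewrite cardsD (setIidPr sZ) cS eJf => cS'.
(* Now [size s <= (k - 3) * (k - 2)] while [size s > n - 2 * k]; up to [k = 6] the bound [n >= 24]
   decides, beyond it [n_ge]. *)
move: (k) (n) #|Z| (size s) cS' cZ szk n_ge n_ge24 k3; clear=> k n z l c1 c2 c3 c4 c5 c6.
case: (leqP k 6) => h; last by nia.
have E : k = 3 \/ k = 4 \/ k = 5 \/ k = 6 by clear - c6 h; lia.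
by case: E => [E|[E|[E|E]]]; subst k; lia.
Qed.

End Stuck.

(** * Cycles of length [n - 1] *)

Lemma next_cons v (s : seq T) u : uniq (v :: s) -> u \in s ->
  u != last v s -> next (v :: s) u = next s u.
Proof.
move=> uvs su nl; case/splitPr: su uvs nl => p [|c q] uvs nl.
  by rewrite last_cat /= eqxx in nl.
by rewrite -cat_cons next_mid // next_mid //; case/andP: uvs.
Qed.

(* Both [s] and [v :: s] are cycles, so besides one-vertex extensions of
   [v :: s] also two-vertex extensions of [s] are excluded. *)
Lemma triangle_cycle_contradiction a b v s : walk e a b s -> uniq (v :: s) ->
  {subset v :: s <= A} -> size s = n - 2 -> e b a -> e v a -> e b v -> False.
Proof.
move=> ws uvs vsA szs eba eva ebv.
have /andP[nvs us] := uvs.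
have cs : cycle e s := walk_cycle ws eba.
have cvs : cycle e (v :: s) := walk_cycle (walk_cons eva ws) ebv.
have lb : last v s = b by case: s ws {uvs vsA szs nvs us cs cvs} => // c s /and3P[_ _ /eqP].
have sb : b \in s.
  by rewrite -lb; case: s ws {uvs vsA szs nvs us cs cvs lb} => // c s _; exact: (mem_last c s).
have sA : {subset s <= A} by move=> z zs; apply: vsA; rewrite inE zs orbT.
have cS : #|[set z in v :: s]| = n - 1.
  by rewrite cardsE (card_uniqP uvs) /= szs; move: n_ge24; clear; lia.
have [|J [sJ iJ cJ]] := dom_set (X := [set z in v :: s]); first by rewrite cS.
have JA x : x \in J -> x \in A by move/(subsetP sJ); rewrite inE => /andP[].
have nJ x : x \in J -> x \notin v :: s by move/(subsetP sJ); rewrite in_setD inE => /andP[].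
have sJA : J \subset A by apply/subsetP.
have noext x : forall s', cycle e s' -> uniq s' -> perm_eq s' ((v :: s) ++ [:: x]) -> False.
  move=> s' cs' us' ps'; apply: noC cs' us' _.
  by rewrite (perm_size ps') size_cat /= szs; move: n_ge24; clear; lia.
(* [b] is left out because it is the one vertex of [s] whose successors on [s] and on [v :: s]
   differ. *)
pose D x := [set u in s | e x u & u != b].
have DP x u : u \in D x -> [/\ u \in s, e x u & u != b] by rewrite inE => /and3P.
have nextD x u : u \in D x -> next (v :: s) u = next s u.
  by case/DP => su _ nb; apply: next_cons; rewrite ?lb.
have dD x : x \in J -> #|D x| <= k - 3.
  move=> Jx; have Ax := JA x Jx; have nx := nJ x Jx.
  have dlt := not_extendable_degree cvs uvs vsA Ax nx (@noext x).
  have [I [sI iI cI]] := outside_alpha3 Ax dlt.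
  have [_ H2] := not_extendable cvs uvs nx (@noext x).
  have IP z : z \in I -> [/\ z \in A, e x z & z \notin v :: s].
    by move/(subsetP sI); rewrite inE => /and3P.
  suff : #|I| + #|D x| <= k by rewrite cI; clear; lia.
  apply: (indep_next us sA) => //.
  - by apply/subsetP => z /IP[].
  - by move=> z /IP[_ _]; rewrite inE negb_or => /andP[].
  - by move=> u /DP[].
  - move=> u u' Du Du'; rewrite -(nextD x u Du) -(nextD x u' Du').
    have [[su xu _] [su' xu' _]] := (DP _ _ Du, DP _ _ Du').
    by apply: H2; rewrite // inE ?su ?su' orbT.
  (* Inserting [x, z] into [s], which has length [n - 2], would give a [C_n]. *)
  move=> z u /IP[Az exz nz] /DP[su xu _]; apply/negP => ezn.
  have pW : path e x [:: z] by rewrite /= exz.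
  have uW : uniq [:: x; z].
    by rewrite /= inE andbT; apply/eqP => E; rewrite E e_irr in exz.
  have dW : ~~ has (mem s) [:: x; z].
    move: nx nz; rewrite /= orbF !inE !negb_or => /andP[_ ->] /andP[_ ->].
    by [].
  have eux : e u x by rewrite e_sym.
  have [s' cs' [us' ps']] := cycle_insert cs us su pW uW dW eux ezn.
  apply: noC cs' us' _; rewrite (perm_size ps') size_cat /= szs.
  by move: n_ge24; clear; lia.
have cS' : #|[set z in s] :\ b| = n - 3.
  have := cardsD1 b [set z in s]; rewrite inE sb cardsE (card_uniqP us) szs.
  by move: n_ge24; clear; lia.
have : #|[set z in s] :\ b| <= #|J| * (k - 3).
  apply: (card_cover (e := e)) => [u|x Jx].
    rewrite !inE => /andP[nb su]; apply: dominates => //; first exact: sA.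
    by apply/negP => /nJ; rewrite inE su orbT.
  apply: leq_trans (dD x Jx); apply: subset_leq_card; apply/subsetP => u.
  by rewrite !inE => /andP[/andP[-> ->] ->].
rewrite cS' cJ; move: (k) (n) n_ge n_ge24; clear => k n c1 c2 c3.
case: (leqP k 6) => h; last by nia.
have : k * (k - 3) <= 18 by nia.
lia.
Qed.

Lemma sum_bool (S : {set T}) (P : pred T) :
  \sum_(u in S) (P u : nat) = #|[set u in S | P u]|.
Proof.
rewrite -sum1_card big_mkcond [RHS]big_mkcond; apply: eq_bigr => u _.
by rewrite inE; case: (u \in S); case: (P u).
Qed.

Lemma walk_uniq1 a s : walk e a a s -> uniq s -> s = [:: a].
Proof.
case: s => // c [|d s] /and3P[/eqP-> _ //] /eqP la.
by rewrite cons_uniq /= in la * => /andP[]; rewrite -{1}la mem_last.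
Qed.

(** Count for each vertex of the cycle its neighbours in [J], once more if there is only one: the
    total is at least [2 * (n - 1)]. Each [x] in [J] contributes at most [k - 1] neighbours and at
    most [(k - 1) / 2] private ones. *)
Lemma penultimate_cycle_contradiction s : cycle e s -> uniq s ->
  {subset s <= A} -> size s = n - 1 -> False.
Proof.
move=> cs us sA szs.
have cS : #|[set z in s]| = n - 1 by rewrite cardsE (card_uniqP us).
have [|J [sJ iJ cJ]] := dom_set (X := [set z in s]); first by rewrite cS.
have JA x : x \in J -> x \in A by move/(subsetP sJ); rewrite inE => /andP[].
have nJ x : x \in J -> x \notin s by move/(subsetP sJ); rewrite !inE => /andP[].
have sJA : J \subset A by apply/subsetP.
have n1 : (n - 1).+1 = n by move: n_ge24; clear; lia.
have noext x : forall s', cycle e s' -> uniq s' -> perm_eq s' (s ++ [:: x]) -> False.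
  move=> s' cs' us' ps'; apply: noC cs' us' _.
  by rewrite (perm_size ps') size_cat /= szs addn1.
have F x : x \in J -> forall u, u \in s -> e x u -> ~~ e x (next s u).
  by move=> Jx; have [] := not_extendable cs us (nJ x Jx) (@noext x).
have dom u : u \in s -> exists2 x, x \in J & e x u.
  move=> su; apply: dominates => //; first exact: sA.
  by apply/negP => /nJ; rewrite su.
pose Pr x := [set u in s | e x u & [forall y in J, e y u ==> (y == x)]].
have PrP x u : u \in Pr x -> [/\ u \in s, e x u & forall y, y \in J -> e y u -> y = x].
  rewrite inE => /and3P[su xu /forall_inP H]; split=> // y Jy eyu.
  by apply/eqP; have := H y Jy; rewrite eyu.
(* Two non-adjacent private neighbours could replace [x] in [J], giving [k + 1] independent
   vertices. *)
have PrC x : x \in J -> clique (Pr x).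
  move=> Jx; apply/cliqueP => u u' Pu Pu' nuu; apply/idPn => neu.
  have [[su xu Hu] [su' xu' Hu']] := (PrP _ _ Pu, PrP _ _ Pu').
  suff : #|[set u; u'] :|: (J :\ x)| <= k.
    rewrite cardU_disj ?cards2 ?nuu; last first.
      by move=> z /set2P[]-> ; rewrite !inE; apply/negP => /andP[_ /nJ]; rewrite ?su ?su'.
    by have := cardsD1 x J; rewrite Jx cJ; clear; lia.
  apply: indep_leq.
    rewrite !subUset !sub1set !sA // (subset_trans (subD1set _ _)) //.
  apply: indepU => //; first exact: indep2.
    exact: indep_sub (subD1set _ _) iJ.
  move=> z y /set2P[]-> /setD1P[nyx Jy]; rewrite e_sym; apply: contra nyx => eyz;
    apply/eqP; [exact: Hu | exact: Hu'].
have nn2 c : c \in s -> next s c != c /\ next s (next s c) != c.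
  move=> sc; have nc := next_neq e_irr cs sc; split=> //; apply/eqP => E.
  have sn : next s c \in s by rewrite mem_next.
  rewrite eq_sym in nc; have [p [q [pp _ wp wq]]] := cut2 cs us sc sn nc.
  have upq : uniq (p ++ q) by rewrite (perm_uniq pp).
  rewrite E in wq; have [up _ uq] : [/\ uniq p, ~~ has (mem p) q & uniq q].
    by apply/and3P; rewrite -cat_uniq.
  have := perm_size pp; rewrite (walk_uniq1 wp up) (walk_uniq1 wq uq) szs /=.
  by move: n_ge24; clear; lia.
(* Such a chord would make [s] without [next s c] a cycle as well, the situation of
   [triangle_cycle_contradiction]. *)
have noChord c : c \in s -> ~~ e c (next s (next s c)).
  move=> sc; apply/negP => ec; have [nc nc2] := nn2 c sc.
  have sn : next s c \in s by rewrite mem_next.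
  have nc' : c != next s c by rewrite eq_sym.
  have [p [q [pp _ wp wq]]] := cut2 cs us sc sn nc'.
  have upq : uniq (p ++ q) by rewrite (perm_uniq pp).
  have [up _ uq] : [/\ uniq p, ~~ has (mem p) q & uniq q].
    by apply/and3P; rewrite -cat_uniq.
  have pE := walk_uniq1 wp up; rewrite pE /= in pp upq.
  apply: (triangle_cycle_contradiction wq upq) => //.
  - by move=> z; rewrite (perm_mem pp); exact: sA.
  - by have := perm_size pp; rewrite /= szs => /eqP; move: n1; clear; lia.
  - exact: next_cycle.
  - exact: next_cycle.
(* First and second successors of private neighbours. By [cover] each has a neighbour in [J :\ x],
   and by [F] and [noPP] no member of [J :\ x] sees two of them; this bounds [#|Pr x|]. *)
pose N1 x := next s @: Pr x; pose N2 x := next s @: N1 x.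
have N1s x c : c \in N1 x -> c \in s by case/imsetP => u /PrP[su _ _] ->; rewrite mem_next.
have N2s x c : c \in N2 x -> c \in s by case/imsetP => u /N1s su ->; rewrite mem_next.
have cover x c : x \in J -> c \in N1 x :|: N2 x -> exists2 y, y \in J :\ x & e y c.
  move=> Jx Nc; have sc : c \in s by case/setUP: Nc => [/N1s|/N2s].
  have [y Jy eyc] := dom c sc.
  have [yx|nyx] := eqVneq y x; last by exists y; rewrite // !inE nyx.
  rewrite yx in eyc; case/setUP: Nc => [/imsetP[a /PrP[sa xa _] E]|].
    by have := F x Jx a sa xa; rewrite -E eyc.
  case/imsetP=> _ /imsetP[a Pa ->] E; have [sa xa _] := PrP _ _ Pa.
  (* If [c] were private too, it would be adjacent to [a] in the clique [Pr x], against
     [noChord]. *)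
  have [Pc|nPc] := boolP (c \in Pr x).
    have := noChord a sa; rewrite -E (cliqueP _ _ (PrC x Jx)) // E eq_sym.
    by have [] := nn2 a sa.
  move: nPc; rewrite inE sc eyc /= negb_forall_in => /exists_inP[z Jz].
  by rewrite negb_imply => /andP[ezc nzx]; exists z; rewrite // !inE nzx.
(* Private neighbours [a], [b] of [x] are adjacent, so [C] can be cut after
   [a] and [b] and reconnected through [x] or [ab] on one side, [y] on the
   other; the three cases give a [C_n], a [C_n] and a triangle cycle. *)
have noPP x y a b : x \in J -> y \in J -> x != y -> a \in Pr x -> b \in Pr x -> a != b ->
    [/\ ~~ (e y (next s a) && e y (next s b)),
        ~~ (e y (next s a) && e y (next s (next s b))) &
        ~~ (e y (next s (next s a)) && e y (next s (next s b)))].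
  move=> Jx Jy nxy Pa Pb nab.
  have [[sa xa _] [sb xb _]] := (PrP _ _ Pa, PrP _ _ Pb).
  have eab : e a b := cliqueP _ _ (PrC x Jx) a b Pa Pb nab.
  have ax : e a x by rewrite e_sym.
  have nax : next s a != b.
    by apply/eqP => E; have := F x Jx a sa xa; rewrite E xb.
  have nbx : next s b != a.
    by apply/eqP => E; have := F x Jx b sb xb; rewrite E xa.
  have [p [q [pp nx wp wq]]] := cut2 cs us sa sb nab.
  have upq : uniq (p ++ q) by rewrite (perm_uniq pp).
  have spq : size p + size q = n - 1 by rewrite -size_cat (perm_size pp).
  have [q' qE wq'] : exists2 q', q = next s b :: q' & walk e (next s (next s b)) a q'.
    have := @walk_behead _ e p (next s b) a q [::]; rewrite cats0.
    by move=> /(_ upq wq nbx)[q' E w]; exists q' => //; rewrite -nx.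
  have [p' pE wp'] : exists2 p', p = next s a :: p' & walk e (next s (next s a)) b p'.
    have := @walk_behead _ e [::] (next s a) b p q => /=.
    by move=> /(_ upq wp nax)[p' E w]; exists p' => //; rewrite -nx.
  have nin z : z \in J -> z \notin p ++ q by move/nJ; rewrite (perm_mem pp).
  have wr := walk_rev e_sym wp; have wr' := walk_rev e_sym wp'.
  split; apply/negP => /andP[e1 e2]; have e1' := e1; rewrite e_sym in e1'.
  - have w : walk e b a (rev p ++ y :: q) := walk_cat wr e1' (walk_cons e2 wq).
    apply: (noC (walk_cycle w eab)).
      have pe : perm_eq (rev p ++ y :: q) (y :: p ++ q).
        by rewrite perm_catC /= perm_cons perm_catC perm_cat2r perm_rev.
      by rewrite (perm_uniq pe) /= upq nin.
    by rewrite size_cat size_rev /= addnS spq.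
  - have w : walk e b x ((rev p ++ y :: q') ++ [:: x]).
      exact: walk_cat (walk_cat wr e1' (walk_cons e2 wq')) ax (walk1 e x).
    apply: (noC (walk_cycle w xb)).
      have pe : perm_eq ((rev p ++ y :: q') ++ [:: x]) (x :: y :: p ++ q').
        rewrite perm_catC /= perm_cons perm_catC /= perm_cons perm_catC.
        by rewrite perm_cat2r perm_rev.
      have ss : subseq (p ++ q') (p ++ q) by rewrite qE cat_subseq // subseq_cons.
      have nin' z : z \in J -> z \notin p ++ q'.
        by move/nin; apply: contra; exact: mem_subseq.
      rewrite (perm_uniq pe) !cons_uniq (subseq_uniq ss) // andbT inE negb_or nxy /=.
      by rewrite !nin'.
    by move: spq n1; rewrite qE !size_cat size_rev /=; clear; lia.
  - have w : walk e b a (rev p' ++ y :: q') := walk_cat wr' e1' (walk_cons e2 wq').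
    have pe : perm_eq (rev p' ++ y :: q') (y :: p' ++ q').
      by rewrite perm_catC /= perm_cons perm_catC perm_cat2r perm_rev.
    have ss : subseq (p' ++ q') (p ++ q).
      by rewrite qE pE cat_subseq // subseq_cons.
    have nin' z : z \in J -> z \notin p' ++ q'.
      by move/nin; apply: contra; exact: mem_subseq.
    apply: (triangle_cycle_contradiction w _ _ _ eab xb ax).
    + rewrite cons_uniq (perm_mem pe) (perm_uniq pe) cons_uniq (subseq_uniq ss) //.
      rewrite andbT inE negb_or nxy /=.
      by rewrite !nin'.
    + move=> z; rewrite inE (perm_mem pe) inE => /or3P[/eqP->|/eqP->|/(mem_subseq ss)];
        [exact: JA|exact: JA|].
      by rewrite (perm_mem pp); exact: sA.
    + rewrite (perm_size pe) /= size_cat; move: spq; rewrite pE qE /= addnS; move: n1.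
      by clear; lia.
have cPr x : x \in J -> 2 * #|Pr x| <= k - 1.
  move=> Jx; have cN1 : #|N1 x| = #|Pr x| by rewrite card_next.
  have cN2 : #|N2 x| = #|Pr x| by rewrite card_next.
  have <- : #|N1 x :|: N2 x| = 2 * #|Pr x|.
    rewrite cardU_disj ?cN1 ?cN2 ?mul2n ?addnn // => z /imsetP[a Pa zE].
    apply/negP => /imsetP[_ /imsetP[b Pb ->]]; rewrite zE => /(next_inj us) E.
    have [[sa xa _] [sb xb _]] := (PrP _ _ Pa, PrP _ _ Pb).
    by have := F x Jx b sb xb; rewrite -E xa.
  have <- : #|J :\ x| * 1 = k - 1.
    by have := cardsD1 x J; rewrite Jx cJ; clear; lia.
  apply: (card_cover (e := e)) => [u|y]; first exact: cover.
  case/setD1P=> nyx Jy; rewrite leqNgt; apply/negP => /card_gt1P[c [c' []]].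
  rewrite !inE => /andP[Nc yc] /andP[Nc' yc'] ncc.
  have nxy : x != y by rewrite eq_sym.
  have key a b : a \in Pr x -> b \in Pr x -> e y (next s a) ->
      e y (next s (next s b)) -> False.
    move=> Pa Pb e1 e2; have [ab|nab] := eqVneq a b.
      have [sa xa _] := PrP _ _ Pa; rewrite -ab in e2.
      by have := F y Jy (next s a); rewrite mem_next e1 e2 => /(_ sa isT).
    by have [_ /negP[]] := noPP x y a b Jx Jy nxy Pa Pb nab; rewrite e1.
  case/orP: Nc => [/imsetP[a Pa cE]|/imsetP[_ /imsetP[a Pa ->] cE]];
  case/orP: Nc' => [/imsetP[b Pb cE']|/imsetP[_ /imsetP[b Pb ->] cE']];
  rewrite cE in yc ncc; rewrite cE' in yc' ncc.
  - have nab : a != b by apply: contraNneq ncc => ->.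
    by have [/negP[]] := noPP x y a b Jx Jy nxy Pa Pb nab; rewrite yc.
  - exact: (key a b).
  - exact: (key b a).
  - have nab : a != b by apply: contraNneq ncc => ->.
    by have [_ _ /negP[]] := noPP x y a b Jx Jy nxy Pa Pb nab; rewrite yc.
have cD x : x \in J -> #|[set u in [set z in s] | e x u]| <= k - 1.
  move=> Jx; have := not_extendable_degree cs us sA (JA x Jx) (nJ x Jx) (@noext x).
  rewrite (_ : [set u in [set z in s] | e x u] = [set u in s | e x u]).
    by move: k_ge2; clear; lia.
  by apply/setP => u; rewrite !inE.
have cPr' x : [set u in [set z in s] | u \in Pr x] = Pr x.
  by apply/setP => u; rewrite !inE; case: (u \in s).
have two : 2 * (n - 1) <= \sum_(x in J) (\sum_(u in [set z in s]) (e x u + (u \in Pr x))).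
  rewrite exchange_big /= mulnC -cS -sum_nat_const; apply: leq_sum => u.
  rewrite inE => su; have [x Jx exu] := dom u su.
  rewrite (bigD1 x) //= exu.
  have [//|nPu] := boolP (u \in Pr x).
  move: nPu; rewrite inE su exu /= negb_forall_in => /exists_inP[y Jy].
  rewrite negb_imply => /andP[eyu nyx].
  by rewrite (bigD1 y) /= ?Jy ?nyx // eyu; clear; lia.
have le x : x \in J -> 2 * (\sum_(u in [set z in s]) (e x u + (u \in Pr x))) <= 3 * (k - 1).
  move=> Jx; rewrite big_split /= (sum_bool _ (e x)) (sum_bool _ (fun u => u \in Pr x)) cPr'.
  rewrite mulnDr; apply: leq_trans (leq_add (leq_mul (leqnn 2) (cD x Jx)) (cPr x Jx)) _.
  by clear; lia.
have : 2 * (2 * (n - 1)) <= k * (3 * (k - 1)).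
  rewrite -cJ -sum_nat_const; apply: leq_trans (leq_mul (leqnn 2) two) _.
  by rewrite big_distrr /=; apply: leq_sum => x Jx; rewrite cJ; exact: le.
(* For [k <= 6] the right side is at most 90, while [n >= 24] makes the left side at least 92;
   larger [k] follow from [n_ge]. *)
move: (k) (n) n_ge n_ge24; clear => k n c1 c2 c3.
case: (leqP k 6) => h; last by nia.
have : k * (3 * (k - 1)) <= 90 by nia.
lia.
Qed.

(** * Conclusion of the dominated case and the induction on [k] *)

Lemma dominated_contradiction : False.
Proof.
have kb := k_bound.
have [x0 Ax0] : exists x0, x0 \in A.
  by apply/card_gt0P; rewrite cardA; move: k_ge2 n_ge24; clear; nia.
(* Tuples make the existence of a cycle of given length boolean, so that [ex_maxnP] can pick the
   largest length below [n]. *)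
pose P l := [exists t : l.-tuple T, [&& cycle e t, uniq t & all (mem A) t]].
have PP l : P l -> exists s, [/\ cycle e s, uniq s, {subset s <= A} & size s = l].
  case/existsP=> t /and3P[ct ut /allP At]; exists t; split=> //; exact: size_tuple.
have PI s : cycle e s -> uniq s -> {subset s <= A} -> P (size s).
  move=> cs us sA; apply/existsP; exists (in_tuple s); rewrite cs us.
  exact/allP.
have [|s0 [cs0 us0 sA0 lt0 gt0]] := mid_cycle Ax0.
  by move: kb n_ge24; clear; lia.
have ex : exists l, P l && (l < n) by exists (size s0); rewrite PI.
have ub l : P l && (l < n) -> l <= n by case/andP=> _ /ltnW.
case: (ex_maxnP ex ub) => l /andP[Pl ltl] maxl.
have [s [cs us sA szs]] := PP l Pl.
have ge0 : size s0 <= l by apply: maxl; rewrite PI.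
have [E|nE] := eqVneq l (n - 1).
  by apply: (penultimate_cycle_contradiction cs us sA); rewrite szs.
apply: (stuck_contradiction cs us sA); rewrite ?szs.
- move=> s' cs' us' sA' /andP[lt le].
  have [E|nE'] := eqVneq (size s') n; first exact: noC cs' us' E.
  have : size s' <= l by apply: maxl; rewrite PI //=; move: le nE'; clear; lia.
  by move: lt; clear; lia.
- by move: nE ltl; clear; lia.
- by move: ge0 gt0; clear; lia.
Qed.

End Dominated.

Lemma clique_system_exists (T : finType) (e : rel T) (n k : nat) (A : {set T}) :
  symmetric e -> irreflexive e ->
  (forall s, cycle e s -> uniq s -> size s <> n) -> 24 <= n ->
  k * (k - 2) <= n -> alpha e A <= k -> #|A| = k * (n - 1) ->
  exists Q, clique_system e n A k Q.
Proof.
move=> e_sym e_irr noC n24; elim/ltn_ind: k A => k IH A kn aA cA.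
have [k0|kp] := posnP k; first by exists (fun=> set0); rewrite k0; split.
pose good (X J : {set T}) := [&& J \subset A :\: X, indep e J & #|J| == k].
have [/forallP H|/forallPn[X]] :=
  boolP [forall X : {set T}, (#|X| <= n - 1) ==> [exists J, good X J]].
  have dom (X : {set T}) : #|X| <= n - 1 ->
      exists J : {set T}, [/\ J \subset A :\: X, indep e J & #|J| = k].
    move=> leX; have := H X; rewrite leX => /existsP[J /and3P[sJ iJ /eqP cJ]].
    by exists J.
  (* For [k = 1] the set [A] itself may be deleted, and nothing is left for [J]. *)
  have [k1|k2] := leqP k 1.
    have [|J [sJ _ cJ]] := dom A; first by rewrite cA; move: k1; clear; nia.
    by rewrite setDv subset0 in sJ; move: cJ; rewrite (eqP sJ) cards0; move: kp; clear; lia.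
  exfalso; apply: (@dominated_contradiction T e e_sym e_irr n k A) => //.
  move=> a B ak aB cB; apply: (IH a ak B) => //.
  by apply: leq_trans kn; move: ak; clear; nia.
rewrite negb_imply => /andP[leX /existsPn noJ].
(* [X] is adjusted to a subset of [A] of size exactly [n - 1], so that it can become a clique of the
   system. *)
have [|X' [sX sX' cX']] := @superset_card T (X :&: A) A (n - 1) (subsetIr _ _).
  rewrite cA (leq_trans (subset_leq_card (subsetIl _ _)) leX) /=.
  by move: kp; clear; nia.
have kE : k = k.-1.+1 by rewrite prednK.
have aX : alpha e (A :\: X') <= k.-1.
  apply/alpha_leP => I sI iI; rewrite leqNgt; apply/negP => lt.
  have [J sJ cJ] : exists2 J : {set T}, J \subset I & #|J| = k.
    by apply: subset_card; rewrite kE.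
  case/negP: (noJ J); rewrite /good cJ eqxx (indep_sub sJ iI) !andbT.
  apply: subset_trans sJ _; apply: subset_trans sI _.
  apply/subsetP => z; rewrite !inE => /andP[nz Az]; rewrite Az andbT.
  by apply: contra nz => Xz; rewrite (subsetP sX) // inE Xz.
have cAX : #|A :\: X'| = k.-1 * (n - 1).
  by rewrite cardsD (setIidPr sX') cA cX' {1}kE mulSn addKn.
have [||Q HQ] := IH k.-1 _ (A :\: X') _ aX cAX; first by rewrite -kE.
  by apply: leq_trans kn; clear; nia.
rewrite kE; apply: (clique_system_add e_sym e_irr noC) sX' cX' HQ _; rewrite -?kE //.
  by move: n24; clear; lia.
by move: kn n24 kp; clear; case: (leqP k 6) => h; [lia|nia].
Qed.

(** * From cycles and independent sets to coloured subgraphs *)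

Lemma cycle_has_subgraph (G : sgraph) n (s : seq G) : 0 < n -> cycle (@adj G) s -> uniq s ->
  size s = n -> has_subgraph G (cycle_graph n).
Proof.
case: s => [|y p] n0 cs us sz; first by rewrite -sz in n0.
subst n; set s := y :: p in cs us *.
have nx (i : 'I_(size s)) : adj (nth y s i) (nth y s (ordS i)).
  have := next_cycle cs (mem_nth y (ltn_ord i)).
  rewrite next_nth mem_nth // /s index_uniq // -/s; congr (adj _ _).
  (* [next] reads the tail of the list with its head [y] as default, so the last index wraps around
     just as [ordS] does. *)
  rewrite /=; have := ltn_ord i; rewrite ltnS leq_eqVlt => /orP[/eqP E|lti].
    by rewrite nth_default ?E // modnn.
  by rewrite modn_small.
exists (fun i : 'I_(size s) => nth y s i) => [i j /eqP|i j].
  by rewrite nth_uniq // => /eqP; exact: val_inj.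
rewrite /= /cycle_rel => /andP[_ /orP[]/eqP->]; first exact: nx.
by rewrite adj_sym nx.
Qed.

Lemma clique_has_subgraph (G : sgraph) m (I : {set G}) :
  (forall x y, x \in I -> y \in I -> x != y -> adj x y) -> #|I| = m ->
  has_subgraph G (complete m).
Proof.
move=> cI <-; exists (fun i : 'I_#|I| => enum_val i); first exact: enum_val_inj.
move=> i j nij; apply: cI; rewrite ?enum_valP //.
by apply: contra nij => /eqP/enum_val_inj->.
Qed.

Lemma red_cycle_or_not (F : sgraph) (c : {set F} -> bool) n : 0 < n ->
  has_subgraph (color_class c true) (cycle_graph n) \/
  forall s : seq F, cycle (color_rel c true) s -> uniq s -> size s <> n.
Proof.
move=> n0; have [/existsP[t /andP[ct ut]]|/existsPn no] :=
  boolP [exists t : n.-tuple F, cycle (color_rel c true) t && uniq t].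
  by left; apply: (@cycle_has_subgraph (color_class c true) n t) => //; exact: size_tuple.
right=> s cs us /eqP sz; have := no (Tuple sz).
by rewrite /= cs us.
Qed.

Lemma blue_clique (F : sgraph) (c : {set F} -> bool) m (I : {set F}) :
  (forall x y, x \in I -> y \in I -> x != y -> adj x y) ->
  indep (color_rel c true) I -> m <= #|I| ->
  has_subgraph (color_class c false) (complete m).
Proof.
move=> aI iI leI; have [J sJ cJ] := subset_card leI.
apply: (@clique_has_subgraph (color_class c false) m J) => // x y Jx Jy nxy.
have [Ix Iy] := (subsetP sJ _ Jx, subsetP sJ _ Jy).
have := indepP _ _ iI x y Ix Iy; rewrite /= /color_rel aI //=.
by case: (c _).
Qed.

(** * Upper bounds for both numbers *)

Section Bounds.
Variables (m n : nat).
Hypotheses (hm : 7 <= m) (hn : (m - 3) * (m - 1) <= n).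

Lemma n_ge24 : 24 <= n.
Proof. by apply: leq_trans hn; move: hm; clear; nia. Qed.

Lemma n_ge_sq : (m - 1) * (m - 1 - 2) <= n.
Proof. by apply: leq_trans hn; move: hm; clear; nia. Qed.

Lemma n_ge_lin : 4 * (m - 1) <= n.
Proof. by move: n_ge24 n_ge_sq hm; clear; nia. Qed.

Lemma ramsey_upper : arrows (complete ((m - 1) * (n - 1) + 1)) (cycle_graph n) (complete m).
Proof.
have n24 := n_ge24; have nlin := n_ge_lin.
have n1 : 1 < n by move: n24; clear; lia.
move=> c; have [red|noC] := red_cycle_or_not c (ltnW n1); [by left | right].
set F := complete _ in c noC *.
have cT : #|[set: F]| = (m - 1) * (n - 1) + 1 by rewrite cardsT card_ord.
have [leA|ltA] := leqP (alpha (color_rel c true) [set: F]) (m - 1); last first.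
  have [I [_ iI cI]] := alpha_witness (color_rel c true) [set: F].
  by apply: (@blue_clique F c m I) => //; rewrite cI; move: ltA; clear; lia.
have [|A sA cA] := @subset_card F [set: F] ((m - 1) * (n - 1)).
  by rewrite cT leq_addr.
have sym : symmetric (color_rel c true) := color_sym c true.
have irr : irreflexive (color_rel c true) := color_irr c true.
have [|Q HQ] := clique_system_exists sym irr noC n24 n_ge_sq _ cA.
  exact: leq_trans (alphaS _ sA) leA.
have [v _ nv] : exists2 v, v \in [set: F] & v \notin A.
  by apply/subsetPn; apply/negP => /subset_leq_card; rewrite cT cA; clear; lia.
have := clique_system_extra sym irr noC _ _ sA HQ (in_setT v) nv.
by move=> /(_ ltac:(clear - n24; lia) ltac:(clear - n24 nlin; lia)); move: leA; clear; lia.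
Qed.

(** The new vertex [v] has at most one red neighbour in each clique and at most [n - 3]
    non-neighbours, so at most one clique is poor in blue neighbours of [v]. Choosing there first,
    where one blue neighbour suffices, lets the greedy choice finish inside the blue
    neighbourhood. *)
Lemma star_upper : arrows (complete_star ((m - 1) * (n - 1)) ((m - 2) * (n - 1) + 2))
  (cycle_graph n) (complete m).
Proof.
have n24 := n_ge24; have nlin := n_ge_lin.
have n1 : 1 < n by move: n24; clear; lia.
move=> c; have [red|noC] := red_cycle_or_not c (ltnW n1); [by left | right].
set N := (m - 1) * (n - 1) in c noC *; set j0 := (m - 2) * (n - 1) + 2 in c noC *.
set F := complete_star N j0 in c noC *.
set k := m - 1 in nlin *.
have NE : N = j0 + (n - 3) by rewrite /N /j0; move: hm n24; clear; nia.
pose e : rel F := color_rel c true.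
have sym : symmetric e := color_sym c true.
have irr : irreflexive e := color_irr c true.
pose v : F := None; pose A : {set F} := [set~ v].
have cA : #|A| = k * (n - 1) by rewrite cardsC1 card_option card_ord.
have adjA (x y : F) : x \in A -> y \in A -> x != y -> adj x y.
  by rewrite !inE; case: x => // x; case: y.
have [leA|ltA] := leqP (alpha e A) k; last first.
  have [I [sI iI cI]] := alpha_witness e A.
  apply: (@blue_clique F c m I) => //; last by rewrite cI; move: ltA; rewrite /k; clear; lia.
  by move=> x y /(subsetP sI) Ax /(subsetP sI) Ay; exact: adjA.
have [Q [HQ HD]] := clique_system_exists sym irr noC n24 n_ge_sq leA cA.
pose Bl := [set x : F | adj v x && ~~ e v x].
pose Mi := [set x in A | ~~ adj v x].
have cMi : #|Mi| <= n - 3.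
  have le : j0 <= N by rewrite NE leq_addr.
  pose f (i : 'I_j0) : F := Some (widen_ord le i).
  have f_inj : injective f by move=> i j [E]; apply: val_inj.
  have : #|Mi :|: f @: [set: 'I_j0]| <= #|A|.
    apply: subset_leq_card; apply/subsetP => z /setUP[|/imsetP[i _ ->]].
      by rewrite inE => /andP[].
    by rewrite !inE.
  rewrite cardU_disj; last first.
    move=> z; rewrite inE => /andP[_ nz]; apply: contra nz => /imsetP[i _ ->].
    exact: (ltn_ord i).
  by rewrite card_imset // cardsT card_ord cA -/N NE; clear; lia.
have nvQ i : i < k -> v \notin Q i.
  by move=> /HQ[sQ _ _]; apply/negP => /(subsetP sQ); rewrite !inE.
have blue i : i < k -> n - 2 <= #|Q i :&: Bl| + #|Q i :&: Mi|.
  move=> ik; have [sQ cQ nQ] := HQ i ik.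
  have red1 := nbr_clique_le1 sym noC n1 cQ nQ (nvQ i ik).
  have : #|Q i| <= #|(Q i :&: Bl) :|: (Q i :&: Mi) :|: [set x in Q i | e v x]|.
    apply: subset_leq_card; apply/subsetP => z Qz; rewrite !inE Qz.
    have : z \in A by exact: (subsetP sQ).
    by rewrite !inE => ->; case: (e v z); case: (@adj F v z).
  rewrite nQ; have [U1 _] := leq_card_setU ((Q i :&: Bl) :|: (Q i :&: Mi)) [set x in Q i | e v x].
  have [U2 _] := leq_card_setU (Q i :&: Bl) (Q i :&: Mi).
  by move: U1 U2 red1; clear; lia.
have kp : 0 < k by rewrite /k; move: hm; clear; lia.
(* Two disjoint cliques cannot both contain more than [(n - 3) / 2] non-neighbours; [i0] is the one
   that does, or 0 if there is none. *)
have [i0 i0k small] : exists2 i0, i0 < k &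
    forall i, i < k -> i != i0 -> 2 * #|Q i :&: Mi| <= n - 3.
  have [/existsP[i big]|/existsPn sm] := boolP [exists i : 'I_k, n - 3 < 2 * #|Q i :&: Mi|].
    exists (i : nat) => // j jk nji.
    have : #|(Q i :&: Mi) :|: (Q j :&: Mi)| <= #|Mi|.
      by apply: subset_leq_card; rewrite subUset !subsetIr.
    rewrite cardU_disj; last first.
      move=> z /setIP[Qi _]; apply/negP => /setIP[Qj _].
      by rewrite (HD j i z jk (ltn_ord i) Qj Qi) eqxx in nji.
    by move: big cMi; clear; lia.
  by exists 0 => // i ik _; have := sm (Ordinal ik); rewrite -leqNgt.
have [z0 /setIP[Qz0 Bz0]] : exists z0, z0 \in Q i0 :&: Bl.
  apply/card_gt0P; have := blue i0 i0k.
  have : #|Q i0 :&: Mi| <= #|Mi| by apply: subset_leq_card; exact: subsetIr.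
  by move: cMi n24; clear; lia.
pose s := [seq i <- iota 0 k | i != i0].
have sP i : i \in s -> i < k /\ i != i0.
  by rewrite mem_filter mem_iota => /andP[-> /andP[_]].
have szs : size s = k - 1.
  have := count_predC (pred1 i0) (iota 0 k).
  rewrite size_iota (count_uniq_mem _ (iota_uniq _ _)) mem_iota add0n i0k /= add1n.
  move=> E; have -> : k - 1 = count (predC (pred1 i0)) (iota 0 k) by rewrite -{1}E subn1.
  by rewrite /s size_filter.
have us : uniq s by rewrite filter_uniq // iota_uniq.
have [|i /sP[ik _]||i x /sP[ik ni] /set1P->|i /sP[ik ni]|I [iI cI HI]] :=
  @greedy_transversal F e sym irr n noC Q (fun i => Q i :&: Bl) s [set z0]
    n1 us.
- exact: indep1.
- by have [_ cQ nQ] := HQ i ik; split=> //; exact: subsetIl.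
- by move=> i j x /sP[ik _] /sP[jk _]; exact: HD.
- by apply: contra ni => Qz; rewrite (HD i i0 z0 ik i0k Qz Qz0).
(* By [blue] and [small] each remaining clique keeps at least [(n - 1) / 2 >= k] blue candidates. *)
- rewrite cards1 szs; have := blue i ik; have := small i ik ni.
  by move: n24 nlin kp; clear; lia.
have IB x : x \in I -> x \in Bl.
  by move/HI => [/set1P->//|[i _ /setIP[]]].
have IA x : x \in I -> x \in A.
  by move/IB; rewrite !inE; case: x.
have nvI : v \notin I by apply/negP => /IA; rewrite !inE.
apply: (@blue_clique F c m (v |: I)).
- move=> x y /setU1P[->|Ix] /setU1P[->|Iy] nxy.
  + by rewrite eqxx in nxy.
  + by have := IB y Iy; rewrite inE => /andP[].
  + by have := IB x Ix; rewrite inE adj_sym => /andP[].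
  + by apply: adjA => //; exact: IA.
- apply: indepU => //; first exact: indep1.
  by move=> x y /set1P-> /IB; rewrite inE => /andP[].
- by rewrite cardsU1 nvI cI cards1 szs /k; move: hm; clear; lia.
Qed.

End Bounds.

(** * Lower bounds from block colourings *)

Section BlockColouring.
Variables (F : sgraph) (blk : F -> nat).

(** For complete [F], red is a disjoint union of cliques and blue is complete multipartite. *)
Definition block_colouring (S : {set F}) : bool :=
  [forall x in S, forall y in S, blk x == blk y].

Lemma block_colouringE x y : block_colouring [set x; y] = (blk x == blk y).
Proof.
apply/forall_inP/idP => [H|/eqP E z /set2P[]->].
- by have := forall_inP (H x (set21 _ _)) y (set22 _ _).
- by apply/forall_inP => t /set2P[]->; rewrite ?E eqxx.
- by apply/forall_inP => t /set2P[]->; rewrite ?E eqxx.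
Qed.

Lemma no_blue_clique m : 0 < m -> (forall x, blk x < m - 1) ->
  ~ has_subgraph (color_class block_colouring false) (complete m).
Proof.
move=> m0 lt [f f_inj f_adj].
pose g (i : 'I_m) := Ordinal (lt (f i)).
have g_inj : injective g.
  move=> i j /(f_equal val)/= E; apply/eqP/idPn => nij.
  by have := f_adj i j nij; rewrite /= /color_rel block_colouringE E eqxx andbF.
by have := leq_card g g_inj; rewrite !card_ord; move: m0; clear; lia.
Qed.

Lemma red_cycle_block n (f : 'I_n -> F) : 1 < n ->
  (forall x y, @adj (cycle_graph n) x y ->
     @adj (color_class block_colouring true) (f x) (f y)) ->
  forall i j, blk (f i) = blk (f j).
Proof.
move=> n1 f_adj.
have step i : blk (f (ordS i)) = blk (f i).
  have /f_adj : @adj (cycle_graph n) i (ordS i).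
    rewrite /= /cycle_rel eqxx andbT; apply/eqP => /(f_equal val) /=.
    have [lt|] := ltnP i.+1 n; first by rewrite modn_small //; clear; lia.
    have := ltn_ord i => l1 l2; have E : i.+1 = n by move: l1 l2; clear; lia.
    by rewrite E modnn; move: E n1; clear; lia.
  by rewrite /= /color_rel block_colouringE => /andP[_]; rewrite eqb_id eq_sym => /eqP.
pose o : 'I_n := Ordinal (ltnW n1).
suff H l (lt : l < n) : blk (f (Ordinal lt)) = blk (f o).
  by case=> i hi [j hj]; rewrite !H.
elim: l lt => [|l IH] lt; first by congr (blk (f _)); apply: val_inj.
rewrite -(IH (ltnW lt)) -(step (Ordinal (ltnW lt))); congr (blk (f _)); apply: val_inj => /=.
by rewrite modn_small.
Qed.

End BlockColouring.

(** With blocks of [n - 1] consecutive vertices, a red cycle stays in one block, where residues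
    modulo [n - 1] are distinct; so it has fewer than [n] vertices. *)
Lemma ramsey_lower m n N : 0 < m -> 2 < n -> N <= (m - 1) * (n - 1) ->
  ~ arrows (complete N) (cycle_graph n) (complete m).
Proof.
move=> m0 n2 leN H.
pose blk (x : complete N) := (x : 'I_N) %/ (n - 1).
have n1 : 0 < n - 1 by move: n2; clear; lia.
case: (H (block_colouring blk)) => [[f f_inj f_adj]|]; last first.
  apply: no_blue_clique => // x; rewrite /blk ltn_divLR //.
  exact: leq_trans (ltn_ord x) leN.
have same := red_cycle_block (ltnW n2) f_adj.
pose g (i : 'I_n) := Ordinal (ltn_pmod (f i : 'I_N) n1).
have g_inj : injective g.
  move=> i j /(f_equal val)/= E; apply: f_inj; apply: val_inj => /=.
  by rewrite (divn_eq (f i : 'I_N) (n - 1)) (divn_eq (f j : 'I_N) (n - 1)) E [_ %/ _](same i j).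
by have := leq_card g g_inj; rewrite !card_ord; move: n2; clear; lia.
Qed.

Lemma cycle_two_neighbours n (i : 'I_n) : 2 < n ->
  exists l1 l2 : 'I_n, [/\ l1 != l2, @adj (cycle_graph n) i l1 &
                           @adj (cycle_graph n) i l2].
Proof.
move=> n2; have lti := ltn_ord i.
have lt2 : (if (i : nat) == 0 then n - 1 else i - 1) < n by case: ifP; move: lti n2; clear; lia.
pose l1 := ordS i; pose l2 := Ordinal lt2.
have v1 : (l1 : nat) = if i.+1 < n then i.+1 else 0.
  rewrite /=; case: ltnP => [lt|ge]; first by rewrite modn_small.
  by have -> : i.+1 = n by [move: lti ge; clear; lia]; rewrite modnn.
have e2 : ordS l2 = i.
  apply: val_inj => /=; case: eqP => [->|ni].
    by have -> : (n - 1).+1 = n by [move: n2; clear; lia]; rewrite modnn.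
  by rewrite modn_small; move: lti ni; clear; lia.
have [n1 n2' n12] : [/\ i != l1, i != l2 & l1 != l2].
  by split; apply/eqP => /(f_equal val) /=; rewrite -?[_ %% _]/(l1 : nat) ?v1;
    do ?case: ifP; move: lti n2; clear; lia.
exists l1, l2; split=> //=; rewrite /cycle_rel ?n1 ?n2' /=.
  by rewrite eqxx.
by rewrite e2 eqxx orbT.
Qed.

(** The new vertex joins the last block, of which it sees at most the first vertex because
    [j <= (m - 2) * (n - 1) + 1]. Its red degree is at most one, so it lies on no red cycle. *)
Lemma star_lower m n j : 1 < m -> 2 < n -> j < (m - 2) * (n - 1) + 2 ->
  ~ arrows (complete_star ((m - 1) * (n - 1)) j) (cycle_graph n) (complete m).
Proof.
move=> m0 n2 ltj H; set N := (m - 1) * (n - 1) in H.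
pose blk (x : complete_star N j) :=
  if x is Some i then (i : 'I_N) %/ (n - 1) else m - 2.
have n1 : 0 < n - 1 by move: n2; clear; lia.
case: (H (block_colouring blk)) => [[f f_inj f_adj]|]; last first.
  apply: no_blue_clique; first exact: ltnW.
  case=> [x|] /=; last by move: m0; clear; lia.
  by rewrite ltn_divLR //; exact: (ltn_ord x).
have same := red_cycle_block (ltnW n2) f_adj.
have [/existsP[i /eqP fi]|/existsPn nf] := boolP [exists i, f i == None].
  have nbr l : @adj (cycle_graph n) i l -> exists2 t : 'I_N, f l = Some t &
      (t : nat) = (m - 2) * (n - 1).
    move=> /f_adj; rewrite /= /color_rel fi block_colouringE /=.
    case: (f l) => [t|] //= /andP[tj]; rewrite eqb_id => /eqP E.
    exists t => //; have := divn_eq t (n - 1); rewrite -E => tE.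
    by move: tE tj ltj; move: (_ * _) (t %% _) => a b; clear; lia.
  have [l1 [l2 [n12 a1 a2]]] := cycle_two_neighbours i n2.
  have [[t1 f1 v1] [t2 f2 v2]] := (nbr _ a1, nbr _ a2).
  case/eqP: n12; apply: f_inj; rewrite f1 f2; congr Some; apply: val_inj.
  by rewrite /= v1 v2.
have fS i : exists t : 'I_N, f i = Some t.
  by have := nf i; case: (f i) => [t|] // _; exists t.
pose h i : nat := if f i is Some t then (t : 'I_N) : nat else 0.
pose g (i : 'I_n) := Ordinal (ltn_pmod (h i) n1).
have g_inj : injective g.
  move=> i j' /(f_equal val)/= E; apply: f_inj.
  have := same i j'; move: E; rewrite /h; have [t ->] := fS i; have [t' ->] := fS j'.
  rewrite /= => E1 E2; congr Some; apply: val_inj => /=.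
  by rewrite (divn_eq t (n - 1)) (divn_eq t' (n - 1)) E1 E2.
by have := leq_card g g_inj; rewrite !card_ord; move: n2; clear; lia.
Qed.

Theorem theorem1 (m n : nat) (hm : 7 <= m) (hn : (m - 3) * (m - 1) <= n) :
  is_star_critical_number (cycle_graph n) (complete m)
    ((m - 2) * (n - 1) + 2).
Proof.
have n24 := n_ge24 hm hn.
have m0 : 1 < m by move: hm; clear; lia.
have n2 : 2 < n by move: n24; clear; lia.
exists ((m - 1) * (n - 1) + 1); split.
- by split; [rewrite addn1 | exact: ramsey_upper].
- move=> N [_ aN]; rewrite addn1 ltnNge; apply/negP => le.
  exact: ramsey_lower (ltnW m0) n2 le aN.
- rewrite addn1 /=; split; last exact: star_upper.
  (* The required [j <= r.-1] amounts to [2 <= n - 1]. *)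
  by move: hm n24; clear; nia.
- rewrite addn1 /= => j [_ aj]; rewrite leqNgt; apply/negP => lt.
  exact: star_lower m0 n2 lt aj.
Qed.
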